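(* Let $T>0$. Suppose: (1) $H_t(x,p)$, $t\in[0,T]$, $x,p\in\mathbb R^d$, is a real-valued function, continuous in $t$, Lipschitz continuous in $p$ uniformly in $x$, i.e. $$|H_t(x,p)-H_t(x,p')|\le c_1|p-p'|,\qquad p,p'\in\mathbb R^d,\ x\in\mathbb R^d,\ t\in[0,T],$$ with a positive constant $c_1$, and there exists a constant $h>0$ such that $|H_t(x,0)|\le h$ for all $x\in\mathbb R^d$, $t\in[0,T]$; (2) the operators $L_t$ generate a strongly continuous backward propagator $U^{t,s}$ in the Banach space $C_\infty(\mathbb R^d)$ with a common invariant domain $D\subset C^1_\infty(\mathbb R^d)$, and the subspace $C^1_\infty(\mathbb R^d)$ is also invariant, so that the $U^{t,s}$ are also strongly continuous in $C^1_\infty(\mathbb R^d)$, and $$\|U^{t,s}\|_{C^1_\infty\to C^1_\infty}\le c_2,\qquad \|U^{t,s}\|_{C_\infty\to C_\infty}\le c_2$$ for all $t\le s\le T$ and a constant $c_2>0$; (3) the operators $U^{t,s}$ map $C_\infty(\mathbb R^d)$ to $C^1_\infty(\mathbb R^d)$ for $t<s$, and $$\|U^{t,s}\phi\|_{C^1_\infty(\mathbb R^d)}\le w(s-t)\|\phi\|_{C_\infty(\mathbb R^d)}$$ for $t<s<T$ and all $\phi\in C_\infty(\mathbb R^d)$, with an integrable positive function $w$ on $[0,T]$. Then for any terminal data $V^T\in C^1_\infty(\mathbb R^d)$ there exists a unique solution $V(t,x)$, which is of class $C^1_\infty(\mathbb R^d)$ for all $t$, to the mild equation $$V(t,x)=(U^{t,T}V^T)(x)+\int_t^T\big(U^{t,s}H_s(\cdot,\nabla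 V(s,\cdot))\big)(x)\,ds,\qquad t\in[0,T].$$
   Context: $C_\infty(\mathbb R^d)$: continuous functions on $\mathbb R^d$ vanishing at infinity, sup-norm. $C^1_\infty(\mathbb R^d)$: continuously differentiable functions which together with their first derivatives are in $C_\infty(\mathbb R^d)$, with the $C^1$ norm. Solutions are sought as continuous curves $t\mapsto V(t,\cdot)\in C^1_\infty(\mathbb R^d)$, $t\in[0,T]$, with $V(T,\cdot)=V^T$. A backward propagator is a family $U^{t,r}$, $t\le r$, of bounded linear operators with $U^{t,t}=\mathrm{Id}$, $U^{t,s}U^{s,r}=U^{t,r}$ for $t\le s\le r$; strongly continuous means strongly continuous in $t,r$. The family $L_t$ of bounded linear operators $D\to C_\infty(\mathbb R^d)$ ($D$ a Banach space, dense in $C_\infty(\mathbb R^d)$; $L_t$ strongly continuous in $t$) generates $U^{t,r}$ on $D$ if $D$ is invariant and for $f\in D$: $\frac{d}{ds}U^{t,s}f=U^{t,s}L_sf$, $\frac{d}{ds}U^{s,r}f=-L_sU^{s,r}f$, $t\le s\le r$, in $C_\infty(\mathbb R^d)$.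
   Formalization: It is additionally assumed that $H_t(\cdot,\nabla f(\cdot))\in C_\infty(\mathbb R^d)$ for all $f\in C^1_\infty(\mathbb R^d)$, $t\in[0,T]$; otherwise (e.g. $H$ a nonzero constant) $U^{t,s}H_s(\cdot,\nabla V)$ in the mild equation is undefined. *)

(* Defs.v *)
From HB Require Import structures.
From mathcomp Require Import all_boot all_order all_algebra.
From mathcomp Require Import all_classical all_reals all_analysis.

Set Implicit Arguments.
Unset Strict Implicit.
Unset Printing Implicit Defensive.

Import Order.TTheory GRing.Theory Num.Theory.
Import numFieldNormedType.Exports.

Local Open Scope classical_set_scope.
Local Open Scope ring_scope.

Section FunctionSpaces.
Context {R : realType} {d : nat}.
Implicit Types (f : 'rV[R]_d -> R) (x : 'rV[R]_d).

(* The library norm on ['rV[R]_d] is the max-norm. *)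
Definition euclid x : R := Num.sqrt (\sum_(i < d) x ord0 i ^+ 2).

Definition grad f x : 'rV[R]_d := \row_(i < d) 'D_(delta_mx ord0 i) f x.

Definition vanishes_at_infinity f :=
  forall e, 0 < e -> exists M : R, forall x, M < euclid x -> `|f x| < e.

Definition Cinf : set ('rV[R]_d -> R) :=
  [set f | continuous f /\ vanishes_at_infinity f].

Definition C1inf : set ('rV[R]_d -> R) :=
  [set f | [/\ Cinf f, forall x, differentiable f x &
     forall i, Cinf (fun x => grad f x ord0 i)]].

(* [sup] is 0 on unbounded sets, so the two norms below are meaningful only
   on [Cinf] and on [C1inf], respectively. *)
Definition supnorm f : R := sup (range (fun x => `|f x|)).

Definition C1norm f : R := supnorm f + sup (range (fun x => euclid (grad f x))).

End FunctionSpaces.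

(* A function space is given by a carrier [X], closed under the vector space
   operations, and a norm [N] on it; an operator on [X] is a map whose values
   outside [X] are irrelevant. *)
Section Propagators.
Context {R : realType} {E : Type}.
Implicit Types (X : set (E -> R)) (N : (E -> R) -> R).

Definition curve_continuous {S : topologicalType} N (A : set S)
    (F : S -> E -> R) :=
  forall s, A s ->
    (fun s' => N (F s' - F s)) @ within A (nbhs s) --> (0 : R).

(* Derivative of a curve in the norm [N], one-sided at the ends of [A]. *)
Definition curve_derivative N (A : set R) (F : R -> E -> R) (s : R)
    (G : E -> R) :=
  (fun s' => N ((fun x => (s' - s)^-1 * (F s' x - F s x)) - G))
    @ within (A `\ s) (nbhs s) --> (0 : R).

Definition linear_on X (B : (E -> R) -> (E -> R)) :=
  forall (a : R) f g, X f -> X g ->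
    B (fun x => a * f x + g x) = (fun x => a * B f x + B g x).

Definition bounded_operator X N (B : (E -> R) -> (E -> R)) :=
  [/\ forall f, X f -> X (B f), linear_on X B &
      exists C : R, forall f, X f -> N (B f) <= C * N f].

Definition triangle (T : R) : set (R * R) :=
  [set p | [/\ 0 <= p.1, p.1 <= p.2 & p.2 <= T]].

Definition strongly_continuous (T : R) X N
    (U : R -> R -> (E -> R) -> (E -> R)) :=
  forall f, X f -> curve_continuous N (triangle T) (fun p => U p.1 p.2 f).

Record backward_propagator (T : R) X N
    (U : R -> R -> (E -> R) -> (E -> R)) : Prop := {
  propagator_bounded : forall t r, 0 <= t -> t <= r -> r <= T ->
    bounded_operator X N (U t r) ;
  propagator_id : forall t, 0 <= t -> t <= T ->
    forall f, X f -> U t t f = f ;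
  propagator_comp : forall t s r, 0 <= t -> t <= s -> s <= r -> r <= T ->
    forall f, X f -> U t s (U s r f) = U t r f }.

(* The Banach space [D], with its own norm, is viewed as a subspace of [X]
   through the linear injection [j]. *)
Record dense_subspace (D : completeNormedModType R) (j : D -> E -> R) X N
    : Prop := {
  subspace_linear : forall (a : R) u v,
    j (a *: u + v) = (fun x => a * j u x + j v x) ;
  subspace_inj : injective j ;
  subspace_sub : forall u, X (j u) ;
  subspace_dense : forall f, X f -> forall e, 0 < e ->
    exists u, N (f - j u) < e }.

Record generator_family (T : R) (D : completeNormedModType R) X N
    (L : R -> D -> E -> R) : Prop := {
  generator_into : forall t, 0 <= t -> t <= T -> forall u, X (L t u) ;
  generator_linear : forall t, 0 <= t -> t <= T -> forall (a : R) u v,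
    L t (a *: u + v) = (fun x => a * L t u x + L t v x) ;
  generator_bounded : forall t, 0 <= t -> t <= T ->
    exists C : R, forall u, N (L t u) <= C * `|u| ;
  generator_continuous : forall u,
    curve_continuous N `[0, T]%classic (fun t => L t u) }.

(* In the last field [v] is [U s r (j u)] seen in [D]: its existence is the
   invariance of [D]. *)
Record generates (T : R) (D : completeNormedModType R) (j : D -> E -> R) X N
    (L : R -> D -> E -> R) (U : R -> R -> (E -> R) -> (E -> R)) : Prop := {
  generates_subspace : dense_subspace j X N ;
  generates_family : generator_family T X N L ;
  generates_right : forall t s r, 0 <= t -> t <= s -> s <= r -> r <= T ->
    forall u, curve_derivative N `[t, r]%classic (fun s' => U t s' (j u)) s
      (U t s (L s u)) ;
  generates_left : forall t s r, 0 <= t -> t <= s -> s <= r -> r <= T ->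
    forall u, exists2 v, j v = U s r (j u) &
      curve_derivative N `[t, r]%classic (fun s' => U s' r (j u)) s
        (- L s v) }.

End Propagators.

Section MildSolutions.
Context {R : realType} {d : nat}.
Let E := 'rV[R]_d.

Definition mild_integrand (U : R -> R -> (E -> R) -> (E -> R))
    (H : R -> E -> E -> R) (V : R -> E -> R) (t s : R) : E -> R :=
  U t s (fun y => H s y (grad (V s) y)).

(* The library integral is total, so its existence is part of the notion. *)
Record mild_solution (T : R) (U : R -> R -> (E -> R) -> (E -> R))
    (H : R -> E -> E -> R) (VT : E -> R) (V : R -> E -> R) : Prop := {
  mild_C1inf : forall t, 0 <= t -> t <= T -> C1inf (V t) ;
  mild_continuous : curve_continuous C1norm `[0, T]%classic V ;
  mild_terminal : V T = VT ;
  mild_integrable : forall t x, 0 <= t -> t <= T ->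
    (@lebesgue_measure R).-integrable `[t, T]
      (fun s => (mild_integrand U H V t s x)%:E) ;
  mild_eq : forall t x, 0 <= t -> t <= T ->
    V t x = U t T VT x +
      \int[@lebesgue_measure R]_(s in `[t, T]) mild_integrand U H V t s x }.

End MildSolutions.

(* Main.v *)
(** Write the mild equation in terms of the source [g_s = H_s(., grad V_s)]: it
    becomes the fixed-point equation [g = Psi g], where
    [Psi g_t = H_t(., grad (U^{t,T} V^T + \int_t^T U^{t,s} g_s ds))], on bounded
    families of functions of [Cinf] that are measurable in time. Since
    [|grad U^{t,s} f| <= w (s - t) |f|], the map [Psi] contracts the norm
    [sup |g_s x| e^{- l (T - s)}] as soon as [\int_0^T w u e^{- l u} du] is small,
    which holds for large [l] by dominated convergence; so Picard iteration
    converges and the fixed point is unique.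

    The family [g_s] is only pointwise continuous in [s], so the integral is not
    a Riemann integral in [Cinf]. Finite-rank interpolation [f ~ \sum_k f(x_k)
    phi_k], which converges uniformly for every [f] in [Cinf], gives the
    measurability of [s |-> U^{t,s} g_s x] and lets [U^{t,r}] commute with
    pointwise integrals. The latter yields continuity in time of the Duhamel term
    in the C1 norm: up to a small integral over [t <= s <= r] it is [U^{t,r}] applied
    to a fixed function. *)

From HB Require Import structures.
Require Import Defs.
From mathcomp Require Import all_boot all_order all_algebra.
From mathcomp Require Import all_classical all_reals all_analysis.
From mathcomp Require Import measurable_realfun ring lra.
Import Order.TTheory GRing.Theory Num.Theory.
Import numFieldNormedType.Exports.
Local Open Scope classical_set_scope.
Local Open Scope ring_scope.

Set Implicit Arguments.
Unset Strict Implicit.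
Unset Printing Implicit Defensive.

(** * Functions vanishing at infinity *)

Section EpsilonDelta.
Context {R : realType} {V : normedModType R}.

Lemma cvg_epsP (f : V -> R) (x : V) (l : R) :
  f y @[y --> x] --> l <->
  forall e, 0 < e -> exists2 r : R, 0 < r &
    forall y, `|y - x| < r -> `|f y - l| < e.
Proof.
split=> [/cvgrPdist_lt fl e e0|fl].
  have /nbhs_ballP[r r0 rf] := fl _ e0; exists r => // y yx.
  rewrite distrC; apply: rf.
  by rewrite -ball_normE /= distrC.
apply/cvgrPdist_lt => e e0; have [r r0 rf] := fl _ e0.
apply/nbhs_ballP; exists r => // y; rewrite -ball_normE /= => yx.
by rewrite distrC rf// distrC.
Qed.

Lemma continuous_compact_bounded (f : V -> R) (K : set V) :
  compact K -> continuous f -> exists M, forall x, K x -> `|f x| <= M.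
Proof.
move=> cK cf; have /compact_bounded[M [_ Mf]] : compact (f @` K).
  by apply: continuous_compact => //; exact: continuous_subspaceT.
exists (M + 1) => x Kx; apply: (Mf (M + 1)); first by rewrite ltrDl.
by exists x.
Qed.

End EpsilonDelta.

Lemma continuous_lin {R : realType} {S : topologicalType} (a : R) (f g : S -> R) :
  continuous f -> continuous g -> continuous (fun x => a * f x + g x).
Proof.
move=> cf cg x; apply: cvgD; last exact: cg.
by apply: cvgMl_tmp; exact: cf.
Qed.

Lemma continuous_div {R : realType} {S : topologicalType} (f g : S -> R) :
  continuous f -> continuous g -> (forall x, g x != 0) ->
  continuous (fun x => f x / g x).
Proof.
move=> cf cg g0 x; apply: cvgM; first exact: cf.
by apply: cvgV; [exact: g0|exact: cg].
Qed.

Lemma continuous_max_cst {R : realType} {S : topologicalType} (c : R)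
  (f : S -> R) : continuous f -> continuous (fun x => Num.max c (f x)).
Proof.
by move=> cf x; apply: (@continuous_max R S (cst c)); [exact: cvg_cst|exact: cf].
Qed.

Section EuclideanNorm.
Context {R : realType} {d : nat}.
Implicit Types x y v : 'rV[R]_d.

Lemma coord_le_euclid x i : `|x ord0 i| <= euclid x.
Proof.
rewrite /euclid -sqrtr_sqr ler_sqrt ?sqr_ge0//; last first.
  by apply: sumr_ge0 => k _; exact: sqr_ge0.
by rewrite (bigD1 i)//= lerDl; apply: sumr_ge0 => k _; exact: sqr_ge0.
Qed.

Lemma euclid_ge0 x : 0 <= euclid x.
Proof. exact: sqrtr_ge0. Qed.

Lemma sqr_sum_le (r : seq 'I_d) (a : 'I_d -> R) : (forall i, 0 <= a i) ->
  \sum_(i <- r) a i ^+ 2 <= (\sum_(i <- r) a i) ^+ 2.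
Proof.
move=> a0; elim: r => [|k r IH]; first by rewrite !big_nil expr0n.
rewrite !big_cons.
have : 0 <= \sum_(i <- r) a i by apply: sumr_ge0 => *; exact: a0.
by have := a0 k; nra.
Qed.

Lemma euclid_le_sum x : euclid x <= \sum_i `|x ord0 i|.
Proof.
have s0 : 0 <= \sum_i `|x ord0 i| by apply: sumr_ge0.
rewrite /euclid -[leRHS]ger0_norm// -sqrtr_sqr ler_sqrt ?sqr_ge0//.
rewrite (eq_bigr (fun i => `|x ord0 i| ^+ 2)); first exact: sqr_sum_le.
by move=> i _; rewrite real_normK ?num_real.
Qed.

Lemma euclid_le_bound x (b : R) : (forall i, `|x ord0 i| <= b) ->
  euclid x <= d%:R * b.
Proof.
move=> xb; apply: le_trans (euclid_le_sum x) _.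
apply: (@le_trans _ _ (\sum_(i < d) b)); first by apply: ler_sum.
by rewrite sumr_const card_ord mulr_natl.
Qed.

Lemma coord_le_norm x i : `|x ord0 i| <= `|x|.
Proof.
rewrite [leRHS]mx_normrE.
exact: (@le_bigmax _ _ _ 0 (fun ij : 'I_1 * 'I_d => `|x ij.1 ij.2|) (ord0, i)).
Qed.

Lemma norm_le_bound x (b : R) : 0 <= b -> (forall i, `|x ord0 i| <= b) ->
  `|x| <= b.
Proof.
move=> b0 xb; rewrite [leLHS]mx_normrE; apply/bigmax_leP; split => //= -[i k] _.
by rewrite /= (ord1 i).
Qed.

Lemma norm_le_euclid x : `|x| <= euclid x.
Proof. by apply: norm_le_bound (euclid_ge0 x) _ => i; exact: coord_le_euclid. Qed.

Lemma euclid_le_norm x : euclid x <= d%:R * `|x|.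
Proof. by apply: euclid_le_bound => i; exact: coord_le_norm. Qed.

Lemma compact_norm_ball (M : R) : compact [set x : 'rV[R]_d | `|x| <= M].
Proof.
apply: bounded_closed_compact.
  by exists M; split=> [|N MN x /= xM]; rewrite ?num_real ?(le_trans xM (ltW MN)).
rewrite (_ : mkset _ = (fun x => `|x|) @^-1` [set r | r <= M])//.
by apply: closed_comp; [move=> x _; exact: norm_continuous|exact: closed_le].
Qed.

End EuclideanNorm.

Section Cinf.
Context {R : realType} {d : nat}.
Implicit Types (f g : 'rV[R]_d -> R) (x : 'rV[R]_d).

(** The Euclidean norm and the library max-norm are equivalent, so either one can measure distance
    to infinity; the compactness arguments below use the max-norm. *)
Lemma vanishes_normP f : vanishes_at_infinity f <->
  forall e, 0 < e -> exists M : R, forall x, M < `|x| -> `|f x| < e.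
Proof.
split=> fv e /fv[M Mf].
  by exists M => x Mx; apply: Mf; apply: lt_le_trans Mx (norm_le_euclid x).
exists (d%:R * M) => x dMx; apply: Mf.
have [//|xM] := ltrP M `|x|; have := euclid_le_norm x.
rewrite leNgt (le_lt_trans _ dMx)//.
by rewrite ler_wpM2l.
Qed.

Lemma Cinf_bounded f : Cinf f -> exists M, forall x, `|f x| <= M.
Proof.
move=> [cf /vanishes_normP /(_ _ ltr01)[M Mf]].
have [N Nf] := continuous_compact_bounded (@compact_norm_ball R d M) cf.
exists (Num.max 1 N) => x; rewrite le_max; have [xM|Mx] := lerP `|x| M.
  by rewrite (Nf x xM) orbT.
by rewrite (ltW (Mf x Mx)).
Qed.

(** Compactness gives a common radius on the ball of radius [M + 1]. For a point outside it, the
    margin 1 keeps the second point outside the ball of radius [M], where each value is below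
    [e / 2]. *)
Lemma Cinf_unif_continuous f : Cinf f -> forall e, 0 < e ->
  exists2 r : R, 0 < r & forall x y, `|x - y| < r -> `|f x - f y| < e.
Proof.
move=> [cf /vanishes_normP fv] e e0.
have [M Mf] : exists M : R, forall x, M < `|x| -> `|f x| < e / 2.
  by apply: fv; rewrite divr_gt0.
have /compact_near_coveringP K := @compact_norm_ball R d (M + 1).
(* Near-covering compactness for the filter of small radii: local radii merge into one. *)
have [] := K R 0^'+ (fun r x => forall y, `|x - y| < r -> `|f x - f y| < e).
- move=> x _; have /cvg_epsP/(_ (e / 2)) := cf x.
  rewrite divr_gt0// => /(_ isT)[r r0 rf].
  exists (ball x (r / 2), [set s | s < r / 2]); first split.
  + by apply: nbhsx_ballx; rewrite divr_gt0.
  + by apply: nbhs_right_lt; rewrite divr_gt0.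
  move=> [z s] /= []; rewrite -ball_normE /= => xz sr y zy.
  have zxr : `|z - x| < r by rewrite distrC; lra.
  have yxr : `|y - x| < r.
    rewrite -(subrKA z); have := ler_normD (y - z) (z - x).
    by rewrite (distrC y z) (distrC z x); lra.
  have := rf _ zxr; have := rf _ yxr.
  have := ler_normB (f z - f x) (f y - f x).
  by rewrite (_ : f z - f x - (f y - f x) = f z - f y); [lra|ring].
move=> r /= r0 rf.
pose s := Num.min (r / 2) 1.
have s0 : 0 < s by rewrite lt_min divr_gt0//= ltr01.
have sr : s < r by rewrite gt_min; apply/orP; left; lra.
exists s => // x y xys.
have [xM|Mx] := lerP `|x| (M + 1).
  apply: (rf s) => //=; rewrite sub0r normrN gtr0_norm//.
have fx : `|f x| < e / 2 by apply: Mf; apply: lt_trans Mx; rewrite ltrDl.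
have fy : `|f y| < e / 2.
  apply: Mf; have := ler_normD (x - y) y; rewrite subrK.
  have : s <= 1 by rewrite ge_min lexx orbT.
  lra.
by have := ler_normB (f x) (f y); lra.
Qed.

Lemma Cinf_lin (a : R) f g : Cinf f -> Cinf g -> Cinf (fun x => a * f x + g x).
Proof.
move=> [cf fv] [cg gv]; split; first exact: continuous_lin.
move=> e e0; have a0 : 0 < `|a| + 1 by rewrite ltr_wpDl.
have [|M Mf] := fv (e / (2 * (`|a| + 1))); first by rewrite divr_gt0// mulr_gt0.
have [|N Ng] := gv (e / 2); first by rewrite divr_gt0.
exists (Num.max M N) => x; rewrite gt_max => /andP[/Mf fx /Ng gx].
apply: le_lt_trans (ler_normD _ _) _; rewrite normrM.
suff : `|a| * `|f x| <= e / 2 by lra.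
rewrite (_ : e / 2 = (`|a| + 1) * (e / (2 * (`|a| + 1)))); last first.
  by field; rewrite gt_eqF.
by rewrite ler_pM ?normr_ge0// ?lerDl// ltW.
Qed.

Lemma Cinf0 : @Cinf R d (fun=> 0).
Proof.
by split=> [x|e e0]; [exact: cst_continuous|exists 0 => x _; rewrite normr0].
Qed.

Lemma CinfB f g : Cinf f -> Cinf g -> Cinf (fun x => f x - g x).
Proof.
move=> Cf Cg; rewrite (_ : (fun x => _) = fun x => (- 1) * g x + f x).
  exact: Cinf_lin.
by apply/funext => x; rewrite mulN1r addrC.
Qed.

Lemma Cinf_sum (I : Type) (r : seq I) (a : I -> R) (F : I -> 'rV[R]_d -> R) :
  (forall i, Cinf (F i)) -> Cinf (fun x => \sum_(i <- r) a i * F i x).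
Proof.
move=> CF; elim: r => [|k r IH].
  by under eq_fun do rewrite big_nil; exact: Cinf0.
by under eq_fun do rewrite big_cons; exact: Cinf_lin.
Qed.

Lemma Cinf_unif_closed f :
  (forall e, 0 < e -> exists2 g, Cinf g & forall x, `|f x - g x| <= e) ->
  Cinf f.
Proof.
move=> fg; split.
  move=> x; apply/cvg_epsP => e e0.
  have [g [cg _] gf] := fg (e / 4) ltac:(lra).
  have /cvg_epsP/(_ (e / 2) ltac:(lra))[r r0 rg] := cg x.
  exists r => // y /rg gyx; have := gf x; have := gf y.
  have := ler_normB (f y - g y) (f x - g x).
  have := ler_normD (g y - g x) (f y - g y - (f x - g x)).
  by rewrite (_ : _ + (_ - _ - _) = f y - f x); [lra|ring].
move=> e e0; have [g [_ gv] gf] := fg (e / 2) ltac:(lra).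
have [M Mg] := gv (e / 2) ltac:(lra); exists M => x /Mg gx.
have := gf x; have := ler_normD (f x - g x) (g x).
by rewrite subrK; lra.
Qed.

Lemma supnorm_le f (M : R) : (forall x, `|f x| <= M) -> supnorm f <= M.
Proof.
by move=> fM; apply: ge_sup; [exists `|f 0|, 0|move=> _ [x _ <-]].
Qed.

Lemma le_supnorm f (M : R) x : (forall y, `|f y| <= M) -> `|f x| <= supnorm f.
Proof.
move=> fM; apply: ub_le_sup; last by exists x.
by exists M => _ [y _ <-].
Qed.

Lemma Cinf_le_supnorm f x : Cinf f -> `|f x| <= supnorm f.
Proof. by move=> /Cinf_bounded[M Mf]; exact: le_supnorm Mf. Qed.

End Cinf.

(** * Gradients and the C1 norm *)

Section Differentials.
Context {R : realType} {V : normedModType R}.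
Implicit Types (f : V -> R) (x v : V).

(** The bound [C] makes the candidate [df] continuous, as [diff_unique] requires; the estimate is
    the little-o expansion that identifies the differential. *)
Lemma differentiable_epsP f (df : {linear V -> R}) x (C : R) :
  (forall v, `|df v| <= C * `|v|) ->
  (forall e, 0 < e -> exists2 r : R, 0 < r & forall v, `|v| < r ->
     `|f (x + v) - f x - df v| <= e * `|v|) ->
  differentiable f x /\ 'd f x = df :> (V -> R).
Proof.
move=> dfC H.
have cdf : continuous df.
  move=> y; apply/cvg_epsP => e e0.
  have C0 : 0 < `|C| + 1 by rewrite ltr_wpDl.
  exists (e / (`|C| + 1)); first by rewrite divr_gt0.
  move=> z; rewrite ltr_pdivlMr// => zy; rewrite -linearB.
  apply: le_lt_trans (dfC _) _; apply: le_lt_trans zy.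
  by rewrite mulrC ler_wpM2l//; have := ler_norm C; lra.
have E : f \o shift x = cst (f x) + df +o_ 0 id.
  apply/eqaddoP => e e0; have [r r0 rf] := H _ e0.
  near=> v; have vr : `|v| < r.
    near: v; apply/nbhs_ballP; exists r => // z; rewrite -ball_normE /=.
    by rewrite sub0r normrN.
  have := rf _ vr; congr (is_true (`|_| <= _)).
  change (f (x + v) - f x - df v = f (v + x) - (f x + df v)).
  by rewrite (addrC v) opprD addrA.
have dE := diff_unique cdf E.
by split=> //; apply/diff_locallyP; rewrite dE.
Unshelve. all: by end_near. Qed.

(** The one-variable mean value theorem along the segment [t |-> x + t *: v], whose difference
    quotients are those of [f] in direction [v]. *)
Lemma mean_value f x v : (forall y, differentiable f y) ->
  exists2 t : R, 0 <= t <= 1 & f (x + v) - f x = 'D_v f (x + t *: v).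
Proof.
move=> df; pose g t := f (x + t *: v).
have dg (t : R) : is_derive t (1 : R) g ('D_v f (x + t *: v)).
  have E : (fun h : R => h^-1 *: ((g \o shift t) (h *: 1) - g t)) =
      (fun h => h^-1 *: ((f \o shift (x + t *: v)) (h *: v) - f (x + t *: v))).
    apply/funext => h; rewrite /g /= [h *: 1]mulr1 scalerDl.
    by rewrite (addrCA x).
  by split; [rewrite /derivable E; exact: diff_derivable|rewrite /derive E].
have cg : {within `[0, 1], continuous g}.
  apply: continuous_subspaceT => t.
  by apply: differentiable_continuous; apply/derivable1_diffP; case: (dg t).
have [t] := @MVT_segment R g _ 0 1 ler01 (fun t _ => dg t) cg.
rewrite in_itv /= => t01; rewrite subr0 mulr1 /g scale1r scale0r addr0 => gE.
by exists t.
Qed.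

End Differentials.

Section Gradients.
Context {R : realType} {d : nat}.
Implicit Types (f g : 'rV[R]_d -> R) (x v G : 'rV[R]_d).

(** The pairing is seen as a function of [v], so that it carries a [linear] structure and can serve
    as a candidate differential with gradient [G]. *)
Definition rowdot G v : R := \sum_i v ord0 i * G ord0 i.

Fact rowdot_linear G : linear (rowdot G : 'rV[R]_d -> R).
Proof.
move=> a u v; rewrite /rowdot scaler_sumr -big_split /=.
by apply: eq_bigr => i _; rewrite !mxE mulrDl -mulrA.
Qed.

HB.instance Definition _ G :=
  GRing.isLinear.Build R 'rV[R]_d R _ (rowdot G) (rowdot_linear G).

Lemma rowdot_bound G v (b : R) : (forall i, `|G ord0 i| <= b) ->
  `|rowdot G v| <= d%:R * b * `|v|.
Proof.
move=> Gb; apply: le_trans (ler_norm_sum _ _ _) _.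
apply: (@le_trans _ _ (\sum_(i < d) b * `|v|)).
  apply: ler_sum => i _; rewrite normrM mulrC.
  by rewrite ler_pM// coord_le_norm.
by rewrite sumr_const card_ord -mulrA mulr_natl.
Qed.

Lemma derive_grad f x v : differentiable f x -> 'D_v f x = rowdot (grad f x) v.
Proof.
move=> df; rewrite deriveE// {1}(row_sum_delta v) linear_sum /rowdot.
by apply: eq_bigr => i _; rewrite linearZ /= /grad mxE deriveE.
Qed.

Lemma mean_value_grad f x v : (forall y, differentiable f y) ->
  exists2 t : R, 0 <= t <= 1 &
    f (x + v) - f x = rowdot (grad f (x + t *: v)) v.
Proof.
by move=> df; have [t t01 E] := mean_value x v df; exists t; rewrite // -derive_grad.
Qed.

Lemma differentiable_gradP f x G :
  (forall e, 0 < e -> exists2 r : R, 0 < r & forall v, `|v| < r ->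
     `|f (x + v) - f x - rowdot G v| <= e * `|v|) ->
  differentiable f x /\ grad f x = G.
Proof.
move=> H; have [v|df dE] := @differentiable_epsP R _ f (rowdot G) x
  (d%:R * euclid G) _ H.
  by apply: rowdot_bound => i; exact: coord_le_euclid.
split=> //; apply/rowP => i; rewrite mxE deriveE// dE.
change (\sum_k (delta_mx ord0 i : 'rV[R]_d) ord0 k * G ord0 k = G ord0 i).
rewrite (bigD1 i)//= !mxE !eqxx mul1r big1 ?addr0// => k ki.
by rewrite !mxE (negbTE ki) andbF mul0r.
Qed.

Lemma differentiable_grad_eps f x : differentiable f x ->
  forall e, 0 < e -> exists2 r : R, 0 < r & forall v, `|v| < r ->
    `|f (x + v) - f x - rowdot (grad f x) v| <= e * `|v|.
Proof.
move=> df e e0; have [_ /eqaddoP/(_ e e0)] := (diff_locallyP x f).1 df.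
move=> /nbhs_ballP[r r0 rf]; exists r => // v vr.
have : ball 0 r v by rewrite -ball_normE /= sub0r normrN.
move=> /rf; congr (is_true (`|_| <= _)).
change (f (v + x) - (f x + 'd f x v) = f (x + v) - f x - rowdot (grad f x) v).
by rewrite -derive_grad// deriveE// (addrC v) opprD addrA.
Qed.

Lemma grad_increment_le f x v (b : R) : (forall y, differentiable f y) ->
  (forall y i, `|grad f y ord0 i| <= b) ->
  `|f (x + v) - f x| <= d%:R * b * `|v|.
Proof.
by move=> /(mean_value_grad x v)[t _ ->] fb; exact: rowdot_bound.
Qed.

Lemma grad_lin (a : R) f g x : differentiable f x -> differentiable g x ->
  differentiable (fun y => a * f y + g y) x /\
  grad (fun y => a * f y + g y) x = a *: grad f x + grad g x.
Proof.
move=> df dg; have dZf : differentiable (a *: f) x by exact: differentiableZ.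
rewrite (_ : (fun y => _) = a *: f + g); last by apply/funext.
split; first exact: differentiableD.
apply/rowP => i; rewrite !mxE deriveD ?deriveZ//; exact: diff_derivable.
Qed.

Lemma C1inf_lin (a : R) f g : C1inf f -> C1inf g ->
  C1inf (fun x => a * f x + g x).
Proof.
move=> [Cf df Cdf] [Cg dg Cdg]; split; first exact: Cinf_lin.
  by move=> x; have [] := grad_lin a (df x) (dg x).
move=> i; rewrite (_ : (fun x => _) =
    fun x => a * grad f x ord0 i + grad g x ord0 i); first exact: Cinf_lin.
by apply/funext => x; have [_ ->] := grad_lin a (df x) (dg x); rewrite !mxE.
Qed.

Lemma C1inf_sub f g : C1inf f -> C1inf g -> C1inf (f - g) /\
  forall x, grad (f - g) x = grad f x - grad g x.
Proof.
move=> Cf Cg; have E : f - g = fun x => (- 1) * g x + f x.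
  by apply/funext => x; rewrite mulN1r addrC.
rewrite E; split=> [|x]; first exact: C1inf_lin.
case: Cf Cg => [_ df _] [_ dg _].
by have [_ ->] := grad_lin (-1) (dg x) (df x); rewrite scaleN1r addrC.
Qed.

Lemma C1inf_Cinf f : C1inf f -> Cinf f. Proof. by case. Qed.

Lemma C1inf_grad_bounded f : C1inf f ->
  exists M, forall x i, `|grad f x ord0 i| <= M.
Proof.
move=> [_ _ Cdf].
have /choice[M HM] : forall i, exists M, forall x, `|grad f x ord0 i| <= M.
  by move=> i; have [M] := Cinf_bounded (Cdf i); exists M.
exists (\sum_i `|M i|) => x i; apply: le_trans (HM i x) _.
apply: le_trans (ler_norm _) _.
by rewrite (bigD1 i)//= lerDl sumr_ge0.
Qed.

Lemma euclid_grad_le_C1norm f x : C1inf f -> euclid (grad f x) <= C1norm f.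
Proof.
move=> Cf; have [M Mf] := C1inf_grad_bounded Cf.
rewrite /C1norm; apply: ler_wpDl.
  exact: le_trans (normr_ge0 _) (Cinf_le_supnorm 0 (C1inf_Cinf Cf)).
apply: ub_le_sup; last by exists x.
by exists (d%:R * M) => _ [y _ <-]; exact: euclid_le_bound.
Qed.

Lemma grad_le_C1norm f x i : C1inf f -> `|grad f x ord0 i| <= C1norm f.
Proof.
by move=> Cf; apply: le_trans (coord_le_euclid _ _) (euclid_grad_le_C1norm _ Cf).
Qed.

(** For an unbounded gradient the second term of [C1norm] is the default value 0 of [sup], so it is
    nonnegative in every case. *)
Lemma supnorm_le_C1norm f : supnorm f <= C1norm f.
Proof.
rewrite /C1norm lerDl.
have [hs|hs] := pselect (has_sup (range (fun x => euclid (grad f x)))).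
  by apply: le_trans (euclid_ge0 (grad f 0)) _; apply: ub_le_sup; [case: hs|exists 0].
by rewrite sup_out.
Qed.

Lemma le_C1norm f x : C1inf f -> `|f x| <= C1norm f.
Proof.
move=> Cf; apply: le_trans (supnorm_le_C1norm f).
exact: Cinf_le_supnorm (C1inf_Cinf Cf).
Qed.

Lemma C1norm_le f (a b : R) : (forall x, `|f x| <= a) ->
  (forall x i, `|grad f x ord0 i| <= b) -> C1norm f <= a + d%:R * b.
Proof.
move=> fa fb; apply: lerD; first exact: supnorm_le.
apply: ge_sup; first by exists (euclid (grad f 0)), 0.
by move=> _ [x _ <-]; exact: euclid_le_bound.
Qed.

Lemma C1norm_ge0 f : 0 <= C1norm f.
Proof.
apply: le_trans (supnorm_le_C1norm f); rewrite /supnorm.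
have [hs|hs] := pselect (has_sup (range (fun x => `|f x|))).
  by apply: le_trans (normr_ge0 (f 0)) _; apply: ub_le_sup; [case: hs|exists 0].
by rewrite sup_out.
Qed.

End Gradients.

(** * Interpolation on finite grids *)

Section Approximation.
Context {R : realType} {d : nat}.
Implicit Types (f : 'rV[R]_d -> R) (x : 'rV[R]_d).

(** Indexes [2 (n+1)^2 + 1] values per axis: from [-(n+1)] to [n+1] in steps of [1/(n+1)]. *)
Definition grid n := {ffun 'I_d -> 'I_(2 * n.+1 * n.+1).+1}.

Definition node n (k : grid n) : 'rV[R]_d :=
  \row_i ((k i)%:R / n.+1%:R - n.+1%:R).

(** The support radius is twice the mesh: a node within one mesh of [x] then contributes at least
    [1/(n+1)], which bounds the sum of the tents from below. *)
Definition tent n (k : grid n) x : R := Num.max 0 (2 / n.+1%:R - `|x - node k|).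

(* The lower bound [1/(n+1)] in the denominator is inactive on the ball of radius
   [n+1], where the hats form a partition of unity. *)
Definition hat n (k : grid n) x : R :=
  tent k x / Num.max n.+1%:R^-1 (\sum_(l : grid n) tent l x).

Definition interpolate n f x : R := \sum_(k : grid n) f (node k) * hat k x.

Lemma tent_ge0 n (k : grid n) x : 0 <= tent k x.
Proof. by rewrite le_max lexx. Qed.

(** Every coordinate is rounded down to the mesh, at the cost of at most one mesh. *)
Lemma grid_cover n x : `|x| <= n.+1%:R ->
  exists k : grid n, `|x - node k| <= n.+1%:R^-1.
Proof.
move=> xn; have N0 : (0 : R) < n.+1%:R by [].
pose y i := (x ord0 i + n.+1%:R) * n.+1%:R.
have xi i : - n.+1%:R <= x ord0 i <= n.+1%:R.
  by rewrite -ler_norml (le_trans (coord_le_norm x i)).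
have y0 i : 0 <= y i by rewrite mulr_ge0//; have := xi i; lra.
have yt i := Num.Theory.truncn_itv (y0 i).
have yl i : (Num.truncn (y i) < (2 * n.+1 * n.+1).+1)%N.
  rewrite ltnS -(ler_nat R) !natrM; have /andP[+ _] := yt i.
  move=> /le_trans -> //; rewrite /y ler_wpM2r//; have := xi i; lra.
exists [ffun i => Ordinal (yl i)]; apply: norm_le_bound => [|i].
  by rewrite invr_ge0.
rewrite !mxE ffunE /= ler_norml; have := yt i.
set K := (X in X%:R <= _) => /andP[K1 K2].
have -> : x ord0 i - (K%:R / n.+1%:R - n.+1%:R) = (y i - K%:R) * n.+1%:R^-1.
  rewrite /y; move: (n.+1%:R) (lt0r_neq0 N0) => N N1.
  by field.
have i0 : (0 : R) < n.+1%:R^-1 by rewrite invr_gt0.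
rewrite -natr1 -/K in K2; rewrite -[X in _ <= _ <= X]mul1r ler_pM2r//.
apply/andP; split; last by lra.
by apply: (@le_trans _ _ 0); [rewrite oppr_le0 ltW|rewrite mulr_ge0 ?subr_ge0// ltW].
Qed.

Lemma sum_tent_ge n x : `|x| <= n.+1%:R ->
  n.+1%:R^-1 <= \sum_(l : grid n) tent l x.
Proof.
move=> /grid_cover[k xk]; rewrite (bigD1 k)//=.
apply: ler_wpDr; first by apply: sumr_ge0 => *; exact: tent_ge0.
rewrite le_max; apply/orP; right.
by rewrite mulr_natl mulr2n lerBrDr lerD2l.
Qed.

Let den_gt0 n x : 0 < Num.max n.+1%:R^-1 (\sum_(l : grid n) tent l x).
Proof. by rewrite lt_max invr_gt0 ltr0Sn. Qed.

Lemma hat_ge0 n (k : grid n) x : 0 <= hat k x.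
Proof. by rewrite divr_ge0 ?tent_ge0// ltW. Qed.

Lemma sum_hatE n x : \sum_(k : grid n) hat k x =
  (\sum_(k : grid n) tent k x) / Num.max n.+1%:R^-1 (\sum_(l : grid n) tent l x).
Proof. by rewrite -mulr_suml. Qed.

Lemma sum_hat_le1 n x : \sum_(k : grid n) hat k x <= 1.
Proof. by rewrite sum_hatE ler_pdivrMr// mul1r le_max lexx orbT. Qed.

Lemma sum_hat_eq1 n x : `|x| <= n.+1%:R -> \sum_(k : grid n) hat k x = 1.
Proof.
move=> /sum_tent_ge h; rewrite sum_hatE; have := den_gt0 n x.
by rewrite (max_idPr h) => s0; rewrite divff// gt_eqF.
Qed.

Lemma hat_support n (k : grid n) x : hat k x != 0 -> `|x - node k| < 2 / n.+1%:R.
Proof.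
apply: contraNT; rewrite -leNgt => h.
by rewrite /hat /tent (max_idPl _) ?mul0r// subr_le0.
Qed.

Lemma Cinf_hat n (k : grid n) : Cinf (hat k).
Proof.
split; last first.
  apply/vanishes_normP => e e0; exists (2 / n.+1%:R + `|node k|) => x xM.
  have [->|/hat_support h] := eqVneq (hat k x) 0; first by rewrite normr0.
  have := ler_normD (x - node k) (node k); rewrite subrK.
  by move: (2 / n.+1%:R) xM h => u; lra.
have ct (l : grid n) : continuous (tent l).
  apply: continuous_max_cst => x; apply/cvg_epsP => e e0; exists e => // y yx.
  apply: le_lt_trans yx.
  rewrite (_ : _ - _ = `|x - node l| - `|y - node l|); last by ring.
  apply: le_trans (ler_dist_dist _ _) _.
  by rewrite opprB addrA subrK distrC.
have cs (r : seq (grid n)) : continuous (fun x => \sum_(l <- r) tent l x).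
  elim: r => [|l r IH].
    by under eq_fun do rewrite big_nil; exact: cst_continuous.
  under eq_fun do rewrite big_cons -[tent _ _]mul1r.
  by apply: continuous_lin; [exact: ct|exact: IH].
have cm : continuous
    (fun x => Num.max n.+1%:R^-1 (\sum_(l : grid n) tent l x)).
  by apply: continuous_max_cst; exact: cs.
by apply: continuous_div (ct k) cm _ => x; rewrite gt_eqF.
Qed.

Lemma interpolate_le n f (M : R) x : (forall y, `|f y| <= M) ->
  `|interpolate n f x| <= M.
Proof.
move=> fM; have M0 : 0 <= M by apply: le_trans (fM 0).
apply: le_trans (ler_norm_sum _ _ _) _.
apply: (@le_trans _ _ (\sum_(k : grid n) M * hat k x)).
  apply: ler_sum => k _; rewrite normrM (ger0_norm (hat_ge0 k x)).
  by rewrite ler_wpM2r ?hat_ge0.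
rewrite -mulr_sumr -[leRHS]mulr1 ler_wpM2l//; exact: sum_hat_le1.
Qed.

Lemma Cinf_interpolate n f : Cinf (interpolate n f).
Proof. by apply: Cinf_sum => k; exact: Cinf_hat. Qed.

(** The error splits in two. The sum of [(f (node k) - f x) * hat k x] is small by uniform
    continuity, since a hat lives within [2/(n+1)] of its node. The term
    [f x * (\sum_k hat k x - 1)] vanishes on the ball of radius [n+1]; outside it [f x] is small and
    the sum of the hats lies between 0 and 1. *)
Lemma interpolate_cvg f : Cinf f -> forall e, 0 < e ->
  exists n0, forall n x, (n0 <= n)%N -> `|interpolate n f x - f x| <= e.
Proof.
move=> Cf e e0; have e20 : 0 < e / 2 by rewrite divr_gt0.
have [r r0 rf] := Cinf_unif_continuous Cf e20.
have [M Mf] := (vanishes_normP f).1 Cf.2 _ e20.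
(* The first summand forces [2/(n+1) < r], the second [M < n+1]. *)
pose n0 := (Num.truncn (2 / r) + Num.truncn `|M|)%N.
exists n0 => n x n0n.
have nr : 2 / n.+1%:R < r.
  rewrite ltr_pdivrMr// mulrC -ltr_pdivrMr//.
  apply: lt_le_trans (Num.Theory.truncnS_gt _) _.
  by rewrite ler_nat ltnS (leq_trans _ n0n)// leq_addr.
have nM : M < n.+1%:R.
  apply: le_lt_trans (ler_norm _) _.
  apply: lt_le_trans (Num.Theory.truncnS_gt _) _.
  by rewrite ler_nat ltnS (leq_trans _ n0n)// leq_addl.
have -> : interpolate n f x - f x =
    \sum_(k : grid n) (f (node k) - f x) * hat k x +
    f x * (\sum_(k : grid n) hat k x - 1).
  rewrite /interpolate mulrBr mulr1 addrA mulr_sumr -big_split /=.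
  by congr (_ - _); apply: eq_bigr => k _; rewrite -mulrDl subrK.
apply: le_trans (ler_normD _ _) _.
rewrite [leRHS]splitr lerD//.
  apply: le_trans (ler_norm_sum _ _ _) _.
  apply: (@le_trans _ _ (\sum_(k : grid n) e / 2 * hat k x)); last first.
    by rewrite -mulr_sumr -[leRHS]mulr1 ler_pM2l// sum_hat_le1.
  apply: ler_sum => k _; rewrite normrM (ger0_norm (hat_ge0 k x)).
  have [->|/hat_support h] := eqVneq (hat k x) 0; first by rewrite !mulr0.
  rewrite ler_wpM2r ?hat_ge0// ltW// rf// distrC; exact: lt_trans h nr.
have [xn|nx] := lerP `|x| n.+1%:R.
  by rewrite sum_hat_eq1// subrr mulr0 normr0 ltW.
rewrite normrM -[leRHS]mulr1 ler_pM//.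
  by apply/ltW/Mf; exact: lt_trans nM nx.
have := sum_hat_le1 n x.
have : 0 <= \sum_(k : grid n) hat k x by apply: sumr_ge0 => *; exact: hat_ge0.
by rewrite ler_norml; lra.
Qed.

End Approximation.

(** * Integrals depending on a parameter *)

Section DominatedIntegrals.
Context {d0 : measure_display} {T : measurableType d0} {R : realType}.
Variable mu : {measure set T -> \bar R}.
Variables (A : set T) (W : T -> R).
Hypothesis mA : measurable A.
Hypothesis iW : mu.-integrable A (EFin \o W).

Lemma dominated_integrable_EFin (f : T -> R) : measurable_fun A f ->
  (forall s, A s -> `|f s| <= W s) -> mu.-integrable A (EFin \o f).
Proof.
move=> mf fW; apply: (le_integrable mA _ _ iW).
  exact/measurable_EFinP.
by move=> s As /=; rewrite lee_fin (le_trans (fW _ As))// ler_norm.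
Qed.

Lemma dominated_Rintegral_le (f : T -> R) : measurable_fun A f ->
  (forall s, A s -> `|f s| <= W s) ->
  `|\int[mu]_(s in A) f s| <= \int[mu]_(s in A) W s.
Proof.
move=> mf fW; have intf := dominated_integrable_EFin mf fW.
apply: le_trans (le_normr_Rintegral mA intf) _.
by apply: le_Rintegral => //; exact: integrable_norm.
Qed.

Lemma Rintegral_dominated_cvg (f_ : (T -> R)^nat) (f : T -> R) :
  (forall n, measurable_fun A (f_ n)) ->
  (forall s, A s -> f_ ^~ s @ \oo --> f s) ->
  (forall n s, A s -> `|f_ n s| <= W s) ->
  mu.-integrable A (EFin \o f) /\
  \int[mu]_(s in A) f_ n s @[n --> \oo] --> \int[mu]_(s in A) f s.
Proof.
move=> mf_ f_f f_W.
have mf : measurable_fun A f by apply: measurable_fun_cvg mf_ f_f.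
have fW s : A s -> `|f s| <= W s.
  move=> As; apply: (cvgr_to_le (cvg_norm (f_f s As))).
  by apply: nearW => n; exact: f_W.
have intf := dominated_integrable_EFin mf fW; split=> //.
apply: fine_cvg; rewrite fineK; last exact: integrable_fin_num.
apply: (@dominated_cvg _ _ _ mu A mA (fun n s => (f_ n s)%:E) _ (EFin \o W)).
- by move=> n; exact/measurable_EFinP.
- by move=> s As; apply: cvg_EFin; [exact: nearW|exact: f_f].
- by [].
- by [].
- by move=> n s As; rewrite lee_fin f_W.
Qed.

(* Dominated convergence along the filter with countable base [B]; it covers
   limits at a point and at infinity. *)
Lemma Rintegral_dominated_base (X : Type) (B : nat -> set X) (u : X -> T -> R)
  (v : T -> R) :
  (forall m n, (m <= n)%N -> B n `<=` B m) ->
  (forall x, measurable_fun A (u x)) ->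
  (forall x s, A s -> `|u x s| <= W s) ->
  (forall s, A s -> forall e, 0 < e ->
     exists n, forall x, B n x -> `|u x s - v s| < e) ->
  forall e, 0 < e -> exists n, forall x, B n x ->
    `|\int[mu]_(s in A) u x s - \int[mu]_(s in A) v s| < e.
Proof.
move=> dB mu_ uW uv e e0; apply: contrapT => H.
(* A counterexample [x n] is picked in every [B n]. As the sets decrease, [u (x n)] converges
   pointwise to [v], against dominated convergence for sequences. *)
have /choice[x Hx] : forall n, exists x, B n x /\
    e <= `|\int[mu]_(s in A) u x s - \int[mu]_(s in A) v s|.
  move=> n; apply: contrapT => Hn; apply: H; exists n => y By.
  by rewrite ltNge; apply/negP => ey; apply: Hn; exists y.
have [|_] := @Rintegral_dominated_cvg (fun n => u (x n)) v
  (fun n => mu_ (x n)) _ (fun n => uW (x n)).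
  move=> s As; apply/cvgrPdist_lt => r r0; have [n0 Hn0] := uv s As r r0.
  exists n0 => // n /= n0n; rewrite distrC; apply: Hn0.
  by apply: dB n0n _ _; case: (Hx n).
move=> /cvgrPdist_lt/(_ _ e0)[n0 _ /(_ n0 (leqnn _))].
by rewrite distrC ltNge; case: (Hx n0) => _ ->.
Qed.

Lemma Rintegral_lin_sum (I : Type) (r : seq I) (c : I -> R)
  (h : I -> T -> R) : (forall i, mu.-integrable A (EFin \o h i)) ->
  mu.-integrable A (EFin \o (fun s => \sum_(i <- r) c i * h i s)) /\
  \int[mu]_(s in A) (\sum_(i <- r) c i * h i s) =
    \sum_(i <- r) c i * \int[mu]_(s in A) h i s.
Proof.
move=> ih; elim: r => [|i r [IH1 IH2]].
  split.
    rewrite (_ : EFin \o _ = cst 0%E); first exact: integrable0.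
    by apply/funext => s /=; rewrite big_nil.
  by under eq_Rintegral do rewrite big_nil; rewrite Rintegral_cst// mul0r big_nil.
have ci : mu.-integrable A (EFin \o (fun s => c i * h i s)).
  by have := integrableZl mA (c i) (ih i).
split.
  apply: eq_integrable (integrableD mA ci IH1) => // s _ /=.
  by rewrite big_cons EFinD.
under eq_Rintegral do rewrite big_cons.
by rewrite RintegralD// RintegralZl// IH2 big_cons.
Qed.

End DominatedIntegrals.

Lemma invn_lt {R : realType} (r : R) : 0 < r -> exists n, n.+1%:R^-1 < r.
Proof.
move=> r0; exists (Num.truncn r^-1); rewrite invf_plt ?posrE//.
exact: Num.Theory.truncnS_gt.
Qed.

Section ParameterIntegrals.
Context {d0 : measure_display} {T : measurableType d0} {R : realType} {d : nat}.
Variable mu : {measure set T -> \bar R}.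
Variables (A : set T) (W : T -> R) (f : T -> 'rV[R]_d -> R).
Hypothesis mA : measurable A.
Hypothesis iW : mu.-integrable A (EFin \o W).
Hypothesis mf : forall x, measurable_fun A (f ^~ x).
Hypothesis fW : forall s x, A s -> `|f s x| <= W s.

(** Dominated convergence along two countable bases: balls shrinking to [x] give continuity,
    complements of growing balls give the limit 0 at infinity. *)
Lemma Cinf_Rintegral : (forall s, A s -> Cinf (f s)) ->
  Cinf (fun x => \int[mu]_(s in A) f s x).
Proof.
move=> Cf; split.
  move=> x; apply/cvg_epsP => e e0.
  have [| | | |n Hn] := @Rintegral_dominated_base _ _ _ mu A W mA iW 'rV[R]_d
    (fun n => [set y | `|y - x| < n.+1%:R^-1]) (fun y s => f s y) (f ^~ x)
    _ _ _ _ e e0 => //=.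
  - move=> m n mn y /= /lt_le_trans; apply; rewrite lef_pV2 ?posrE//.
    by rewrite ler_nat.
  - by move=> y s; exact: fW.
  - move=> s As r r0; have /cvg_epsP/(_ r r0)[q q0 qf] := (Cf s As).1 x.
    by have [n nq] := invn_lt q0; exists n => y /= yx; apply/qf/(lt_trans yx).
  by exists n.+1%:R^-1; [rewrite invr_gt0|move=> y yx; exact: Hn].
apply/vanishes_normP => e e0.
have [| | | |n Hn] := @Rintegral_dominated_base _ _ _ mu A W mA iW 'rV[R]_d
  (fun n => [set y | n%:R < `|y|]) (fun y s => f s y) (cst 0) _ _ _ _ e e0 => //=.
- by move=> m n mn y /=; apply: le_lt_trans; rewrite ler_nat.
- by move=> y s; exact: fW.
- move=> s As r r0; have [M Mf] := (vanishes_normP _).1 (Cf s As).2 r r0.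
  exists (Num.truncn `|M|).+1 => y /= My; rewrite subr0; apply: Mf.
  apply: le_lt_trans (ler_norm M) _; apply: lt_trans My.
  exact: Num.Theory.truncnS_gt.
exists n%:R => x nx; have := Hn x nx.
by rewrite Rintegral_cst// mul0r subr0.
Qed.

End ParameterIntegrals.

(** * Differentiation under the integral sign *)

Section DifferentiableParameterIntegrals.
Context {d0 : measure_display} {T : measurableType d0} {R : realType} {d : nat}.
Variable mu : {measure set T -> \bar R}.
Variables (A : set T) (W : T -> R) (f : T -> 'rV[R]_d -> R).
Hypothesis mA : measurable A.
Hypothesis iW : mu.-integrable A (EFin \o W).
Hypothesis mf : forall x, measurable_fun A (f ^~ x).
Hypothesis fW : forall s x, A s -> `|f s x| <= W s.
Hypothesis Cf : forall s, A s -> C1inf (f s).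
Hypothesis gW : forall s x i, A s -> `|grad (f s) x ord0 i| <= W s.

(** A partial derivative is the pointwise limit of difference quotients with increments [1/(n+1)],
    each measurable in [s]. *)
Lemma measurable_fun_grad x i :
  measurable_fun A (fun s => grad (f s) x ord0 i).
Proof.
pose v n : 'rV[R]_d := n.+1%:R^-1 *: delta_mx ord0 i.
apply: (@measurable_fun_cvg _ _ _ _
  (fun n s => n.+1%:R * (f s (x + v n) - f s x))).
  move=> n; apply: measurable_funM; first exact: measurable_cst.
  exact: measurable_funB.
move=> s As; apply/cvgrPdist_le => e e0.
have [_ df _] := Cf As.
have [r r0 rf] := differentiable_grad_eps (df x) e0.
have [n0 n0r] := invn_lt r0; exists n0 => // n /= n0n.
have vn : `|v n| <= n.+1%:R^-1.
  apply: norm_le_bound => [|k]; first by rewrite invr_ge0.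
  rewrite !mxE normrM ger0_norm ?invr_ge0// -[leRHS]mulr1 ler_wpM2l ?invr_ge0//.
  by case: (_ && _); rewrite ?normr1 ?normr0.
have vr : `|v n| < r.
  apply: le_lt_trans vn _; apply: le_lt_trans n0r.
  by rewrite lef_pV2 ?posrE// ler_nat.
have -> : grad (f s) x ord0 i = n.+1%:R * rowdot (grad (f s) x) (v n).
  have vE k : v n ord0 k = n.+1%:R^-1 * (k == i)%:R by rewrite !mxE eqxx.
  rewrite /rowdot (bigD1 i)//= big1 => [|k ki].
    by rewrite vE eqxx mulr1 addr0 mulVKf// pnatr_eq0.
  by rewrite vE (negbTE ki) mulr0 mul0r.
rewrite -mulrBr -normrN -mulrN opprB normrM ger0_norm//.
rewrite mulrC -ler_pdivlMr//; apply: le_trans (rf _ vr) _.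
by rewrite ler_pM2l.
Qed.

Let G x : 'rV[R]_d := \row_i \int[mu]_(s in A) grad (f s) x ord0 i.

(** Dominated convergence as [v] tends to 0, applied to the first-order remainder [q v] divided by
    [|v|]: it tends to 0 for each [s] by differentiability and is dominated by a multiple of [W]. *)
Lemma grad_Rintegral x :
  differentiable (fun x => \int[mu]_(s in A) f s x) x /\
  grad (fun x => \int[mu]_(s in A) f s x) x = G x.
Proof.
apply: differentiable_gradP => e e0.
have ifx y : mu.-integrable A (EFin \o f ^~ y).
  by apply: (dominated_integrable_EFin mA iW) => // s; exact: fW.
have igx y i : mu.-integrable A (EFin \o (fun s => grad (f s) y ord0 i)).
  apply: (dominated_integrable_EFin mA iW); first exact: measurable_fun_grad.
  by move=> s; exact: gW.
pose q v s := f s (x + v) - f s x - rowdot (grad (f s) x) v.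
have iq v : mu.-integrable A (EFin \o q v) /\ \int[mu]_(s in A) q v s =
    (\int[mu]_(s in A) f s (x + v)) - (\int[mu]_(s in A) f s x)
      - rowdot (G x) v.
  have [ig gE] := @Rintegral_lin_sum _ _ _ mu A mA _ (index_enum 'I_d)
    (fun i => v ord0 i) (fun i s => grad (f s) x ord0 i) (igx x).
  have iB : mu.-integrable A (EFin \o (fun s => f s (x + v) - f s x)).
    by have := integrableB mA (ifx (x + v)) (ifx x).
  split; first by have := integrableB mA iB ig.
  rewrite /q /rowdot RintegralB// RintegralB// gE; congr (_ - _).
  by apply: eq_bigr => i _; rewrite mxE.
(* By the mean value theorem the increment of [f s] is at most [d * W s * |v|]; the linear term
   obeys the same bound, whence the factor 2. *)
pose W' s := (2 * d%:R) * W s.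
have iW' : mu.-integrable A (EFin \o W').
  by have := integrableZl mA (2 * d%:R) iW.
have [| | | |n Hn] := @Rintegral_dominated_base _ _ _ mu A W' mA iW' 'rV[R]_d
    (fun n => [set v | `|v| < n.+1%:R^-1]) (fun v s => `|v|^-1 * q v s) (cst 0)
    _ _ _ _ e e0 => //=.
- move=> m n mn y /= /lt_le_trans; apply; rewrite lef_pV2 ?posrE//.
  by rewrite ler_nat.
- move=> v; apply: measurable_funM; first exact: measurable_cst.
  by have /measurable_int/measurable_EFinP := (iq v).1.
- move=> v s As; have W0 : 0 <= W s by apply: le_trans (fW x As).
  have [->|v0] := eqVneq v 0.
    by rewrite normr0 invr0 mul0r normr0 mulr_ge0// mulr_ge0.
  have nv0 : 0 < `|v| by rewrite normr_gt0.
  rewrite normrM normfV normr_id mulrC ler_pdivrMr//.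
  have [_ df _] := Cf As.
  have := grad_increment_le x v df (fun y i => gW y i As).
  have := rowdot_bound v (fun i => gW x i As).
  have := ler_normB (f s (x + v) - f s x) (rowdot (grad (f s) x) v).
  rewrite /q /W' -!mulrA; lra.
- move=> s As r r0; have [_ df _] := Cf As.
  have r20 : 0 < r / 2 by rewrite divr_gt0.
  have [p p0 pf] := differentiable_grad_eps (df x) r20.
  have [n np] := invn_lt p0; exists n => v /= vn; rewrite subr0.
  have [->|v0] := eqVneq v 0; first by rewrite normr0 invr0 mul0r normr0.
  have nv0 : 0 < `|v| by rewrite normr_gt0.
  rewrite normrM normfV normr_id mulrC ltr_pdivrMr//.
  apply: le_lt_trans (pf _ (lt_trans vn np)) _.
  by rewrite ltr_pM2r// ltr_pdivrMr// ltr_pMr// ltr1n.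
exists n.+1%:R^-1; first by rewrite invr_gt0.
move=> v vn; have := Hn v vn; rewrite Rintegral_cst// mul0r subr0.
have [_ <-] := iq v; rewrite RintegralZl//; last exact: (iq v).1.
(* Since [0^-1 = 0], the normalised estimate says nothing at [v = 0]; the remainder is zero
   there. *)
have [->|v0] := eqVneq v 0.
  move=> _; rewrite normr0 mulr0 (_ : \int[mu]_(s in A) q 0 s = 0) ?normr0//.
  by rewrite (iq 0).2 addr0 subrr sub0r linear0 oppr0.
have nv0 : 0 < `|v| by rewrite normr_gt0.
by rewrite normrM normfV normr_id mulrC ltr_pdivrMr// => /ltW.
Qed.

Lemma C1inf_Rintegral : C1inf (fun x => \int[mu]_(s in A) f s x).
Proof.
split=> [|x|i].
  by apply: (@Cinf_Rintegral _ _ _ _ mu A W f) => // s /Cf[].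
  by have [] := grad_Rintegral x.
rewrite (_ : (fun x => _) =
  fun x => \int[mu]_(s in A) grad (f s) x ord0 i); last first.
  by apply/funext => x; rewrite (grad_Rintegral x).2 mxE.
apply: (@Cinf_Rintegral _ _ _ _ mu A W (fun s x => grad (f s) x ord0 i)) => //.
- by move=> x; exact: measurable_fun_grad.
- by move=> s x; exact: gW.
- by move=> s /Cf[].
Qed.

End DifferentiableParameterIntegrals.

(** * Bounded functionals and integrals *)

Section BoundedFunctionals.
Context {R : realType} {d : nat}.
Implicit Types (f : 'rV[R]_d -> R) (B : ('rV[R]_d -> R) -> R).

(** Any uniform bound [M] replaces the sup-norm, which avoids handling [sup] in the estimates. *)
Definition bounded_functional B (C : R) :=
  (forall (a : R) f g, Cinf f -> Cinf g ->
     B (fun x => a * f x + g x) = a * B f + B g) /\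
  (forall f (M : R), Cinf f -> (forall x, `|f x| <= M) -> `|B f| <= C * M).

Lemma bounded_functional0 B C : bounded_functional B C -> B (fun=> 0) = 0.
Proof.
move=> [Bl _]; have := Bl (-1) _ _ Cinf0 Cinf0.
rewrite (_ : (fun x : 'rV[R]_d => -1 * 0 + 0) = fun=> 0); last first.
  by apply/funext => x; rewrite mulr0 addr0.
by move=> ->; rewrite mulN1r addNr.
Qed.

Lemma bounded_functional_sum B C (I : Type) (r : seq I) (a : I -> R)
  (F : I -> 'rV[R]_d -> R) : bounded_functional B C ->
  (forall i, Cinf (F i)) ->
  B (fun x => \sum_(i <- r) a i * F i x) = \sum_(i <- r) a i * B (F i).
Proof.
move=> bB CF; elim: r => [|i r IH].
  rewrite big_nil -[RHS](bounded_functional0 bB); congr B.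
  by apply/funext => x; rewrite big_nil.
rewrite big_cons -IH -bB.1//; last exact: Cinf_sum.
by congr B; apply/funext => x; rewrite big_cons.
Qed.

Lemma bounded_functional_interpolate B C n f : bounded_functional B C ->
  B (interpolate n f) = \sum_(k : @grid d n) f (node k) * B (hat k).
Proof.
by move=> bB; apply: bounded_functional_sum bB _ => k; exact: Cinf_hat.
Qed.

Lemma bounded_functional_cvg B C f : bounded_functional B C -> Cinf f ->
  B (interpolate n f) @[n --> \oo] --> B f.
Proof.
move=> bB Cf; apply/cvgrPdist_le => e e0.
have C0 : 0 < `|C| + 1 by rewrite ltr_wpDl.
have [n0 Hn0] := interpolate_cvg Cf (divr_gt0 e0 C0).
exists n0 => // n /= n0n.
have -> : B f - B (interpolate n f) = B (fun x => -1 * interpolate n f x + f x).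
  by rewrite bB.1// ?mulN1r 1?addrC//; exact: Cinf_interpolate.
apply: le_trans (bB.2 _ (e / (`|C| + 1)) _ _) _.
- by apply: Cinf_lin => //; exact: Cinf_interpolate.
- by move=> x; rewrite mulN1r addrC distrC; exact: Hn0.
rewrite mulrC -mulrA ger_pMr// mulrC ler_pdivrMr// mul1r.
by have := ler_norm C; lra.
Qed.

(** Both the functional and its argument vary with [s]. Interpolation separates them: [B s (g s)] is
    the limit of finite sums of products [g s (node k) * B s (hat k)], whose factors are
    measurable. *)
Lemma measurable_fun_functional d0 (T : measurableType d0) (A : set T)
  (B : T -> ('rV[R]_d -> R) -> R) (C : R) (g : T -> 'rV[R]_d -> R) :
  (forall s, A s -> bounded_functional (B s) C) ->
  (forall f, Cinf f -> measurable_fun A (B ^~ f)) ->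
  (forall s, A s -> Cinf (g s)) ->
  (forall x, measurable_fun A (g ^~ x)) ->
  measurable_fun A (fun s => B s (g s)).
Proof.
move=> bB mB Cg mg; apply: (@measurable_fun_cvg _ _ _ _
  (fun n s => \sum_(k : @grid d n) g s (node k) * B s (hat k))).
  move=> n; apply: measurable_sum => k; apply: measurable_funM; first exact: mg.
  exact/mB/Cinf_hat.
move=> s As; under eq_fun do rewrite -(bounded_functional_interpolate _ _ (bB s As)).
exact: bounded_functional_cvg (bB s As) (Cg s As).
Qed.

(* Interpolation reduces the exchange of [B] and the integral to finite sums and
   to scalar dominated convergence. *)
Lemma bounded_functional_Rintegral d0 (T : measurableType d0)
  (mu : {measure set T -> \bar R}) (A : set T) (W : T -> R) B (C : R)
  (f : T -> 'rV[R]_d -> R) :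
  measurable A -> mu.-integrable A (EFin \o W) ->
  bounded_functional B C ->
  (forall s, A s -> Cinf (f s)) ->
  (forall x, measurable_fun A (f ^~ x)) ->
  (forall s x, A s -> `|f s x| <= W s) ->
  B (fun x => \int[mu]_(s in A) f s x) = \int[mu]_(s in A) B (f s).
Proof.
move=> mA iW bB Cf mf fW.
have CF := Cinf_Rintegral mA iW mf fW Cf.
have ifx x : mu.-integrable A (EFin \o f ^~ x).
  by apply: (dominated_integrable_EFin mA iW) => // s; exact: fW.
have iW' : mu.-integrable A (EFin \o (fun s => C * W s)).
  by have := integrableZl mA C iW.
have cvgl := bounded_functional_cvg bB CF.
have [| | |_ cvgr] := @Rintegral_dominated_cvg _ _ _ mu A (fun s => C * W s) mA
    iW' (fun n s => B (interpolate n (f s))) (fun s => B (f s)).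
- move=> n; apply: (measurable_fun_functional (fun s _ => bB)) => [g Cg|s _|].
  - exact: measurable_cst.
  - exact: Cinf_interpolate.
  move=> x; apply: measurable_sum => k; apply: measurable_funM; first exact: mf.
  exact: measurable_cst.
- by move=> s As; exact: bounded_functional_cvg bB (Cf s As).
- move=> n s As; apply: bB.2; first exact: Cinf_interpolate.
  by move=> x; apply: interpolate_le => y; exact: fW.
(* Both sides are limits of one sequence: [B] of the interpolated integral is a finite sum, equal to
   the integral of [B] of the interpolants. *)
apply/esym; apply: (norm_cvg_unique cvgr).
apply: cvg_trans cvgl; apply: near_eq_cvg.
apply: nearW => n; rewrite (bounded_functional_interpolate _ _ bB).
under eq_bigr do rewrite mulrC.
have [_ <-] := @Rintegral_lin_sum _ _ _ mu A mA _ (index_enum (@grid d n))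
  (fun k => B (hat k)) (fun k s => f s (node k)) (fun k => ifx (node k)).
apply: eq_Rintegral => s sA; rewrite (bounded_functional_interpolate _ _ bB).
by apply: eq_bigr => k _; rewrite mulrC.
Qed.

End BoundedFunctionals.

(** * The exponentially weighted kernel *)

Section Translation.
Context {R : realType}.
Notation mu := (@lebesgue_measure R).

Lemma measurable_subr (t : R) :
  measurable_fun [set: measurableTypeR R]
    ((fun s => s - t) : measurableTypeR R -> measurableTypeR R).
Proof.
suff : measurable_fun [set: R] (fun s => s - t) by [].
by apply: measurable_funB => //; exact: measurable_cst.
Qed.

(** Translation preserves the length of half-open intervals, and these determine Lebesgue
    measure. *)
Lemma lebesgue_measure_shift (t : R) (A : set R) : measurable A ->
  pushforward mu ((fun s => s - t) : measurableTypeR R -> measurableTypeR R) A = mu A.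
Proof.
move=> mA; apply/esym.
apply: (@lebesgue_measure_unique R
  (pushforward mu ((fun s => s - t) : measurableTypeR R -> measurableTypeR R))) => //.
  exact: measurable_subr.
move=> ? _ [[a b]] _ <-.
rewrite /pushforward [X in _ = mu X](_ : _ = `]a + t, b + t]%classic).
  rewrite !lebesgue_measure_itv/= !lte_fin ltrD2r.
  by case: ifP => // _; rewrite -!EFinB; congr EFin; ring.
by apply/seteqP; split=> s /=; rewrite !in_itv /= => /andP[]; lra.
Qed.

Lemma ge0_integral_shift (t : R) (D : set R) (f : R -> \bar R) :
  measurable D -> measurable_fun D f -> (forall s, D s -> 0 <= f s)%E ->
  (\int[mu]_(s in [set s | D (s - t)%R]) f (s - t)%R)%E = (\int[mu]_(s in D) f s)%E.
Proof.
move=> mD mf f0.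
pose phi := (fun s => s - t) : measurableTypeR R -> measurableTypeR R.
rewrite (_ : [set s | D (s - t)] = phi @^-1` D)//.
transitivity (\int[mu]_(s in phi @^-1` D) (f \o phi) s)%E => //.
rewrite -(ge0_integral_pushforward (measurable_subr t))//.
  apply: eq_measure_integral => //=; first exact: measurable_subr.
  by move=> ? A mA _; exact: lebesgue_measure_shift.
by move=> s; rewrite inE; exact: f0.
Qed.

End Translation.

Section Weights.
Context {R : realType}.
Notation mu := (@lebesgue_measure R).

Lemma integrable_shift (t : R) (D : set R) (f : R -> R) :
  measurable D -> mu.-integrable D (EFin \o f) -> (forall s, D s -> 0 <= f s) ->
  mu.-integrable [set s | D (s - t)] (EFin \o (fun s => f (s - t))) /\
  \int[mu]_(s in [set s | D (s - t)]) f (s - t) = \int[mu]_(s in D) f s.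
Proof.
move=> mD intf f0; have /integrableP[mf foo] := intf.
have E := @ge0_integral_shift R t D (EFin \o f) mD mf f0.
split; last by rewrite /Rintegral -E.
have msub : measurable_fun [set: R] (fun s => s - t).
  by apply: measurable_funB => //; exact: measurable_cst.
have mDt : measurable [set s | D (s - t)].
  by rewrite -[X in measurable X]setTI; exact: msub.
apply/integrableP; split.
  apply: (measurable_comp mD _ mf); first by move=> _ [s /= Ds <-].
  exact: measurable_funS msub.
apply: le_lt_trans foo; rewrite le_eqVlt; apply/orP; left; apply/eqP.
transitivity (\int[mu]_(s in [set s | D (s - t)%R]) (EFin \o f) (s - t)%R)%E.
  by apply: eq_integral => s; rewrite inE /= => /f0 fs; rewrite ger0_norm.
rewrite E; apply: eq_integral => s; rewrite inE /= => /f0 fs.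
by rewrite ger0_norm.
Qed.

Variables (T : R) (w : R -> R).
Hypothesis T0 : 0 < T.
Hypothesis w0 : forall u, 0 <= u -> u <= T -> 0 < w u.
Hypothesis iw : mu.-integrable `[0, T] (EFin \o w).

(** The Laplace transform of [w] truncated at [a]. The interval is open because the smoothing bound
    is available for [t < s < T] only. *)
Definition weight (l a : R) : R :=
  \int[mu]_(u in `]0, a[) (w u * expR (- (l * u))).

Let subT a : a <= T -> `]0, a[ `<=` `[0, T].
Proof.
move=> aT u /=; rewrite !in_itv /= => /andP[u0 ua].
by rewrite !ltW//= (lt_le_trans ua).
Qed.

Let iwT : mu.-integrable `]0, T[ (EFin \o w).
Proof. by apply: integrableS iw => //; exact: subT. Qed.

Let weight_bound l u : 0 <= l -> 0 < u -> u <= T ->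
  0 <= w u * expR (- (l * u)) <= w u.
Proof.
move=> l0 u0 uT; have wu := w0 (ltW u0) uT.
rewrite mulr_ge0 ?expR_ge0 ?(ltW wu)//= ger_pMr// expR_le1 oppr_le0.
by rewrite mulr_ge0// ltW.
Qed.

Let measurable_weight l : measurable_fun `]0, T[ (fun u => w u * expR (- (l * u))).
Proof.
apply: measurable_funM; first by have /measurable_int/measurable_EFinP := iwT.
by apply: measurableT_comp => //; apply: measurableT_comp => //;
  exact: measurable_funM.
Qed.

Let integrable_weightT l : 0 <= l ->
  mu.-integrable `]0, T[ (EFin \o (fun u => w u * expR (- (l * u)))).
Proof.
move=> l0; apply: (dominated_integrable_EFin _ iwT) => //.
  exact: measurable_weight.
move=> u /=; rewrite in_itv /= => /andP[u0 uT].
by have /andP[wp ww] := weight_bound l0 u0 (ltW uT); rewrite ger0_norm.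
Qed.

Let integrable_weight l a : 0 <= l -> a <= T ->
  mu.-integrable `]0, a[ (EFin \o (fun u => w u * expR (- (l * u)))).
Proof.
move=> l0 aT; apply: integrableS (integrable_weightT l0) => //.
by apply: subset_itvl; rewrite bnd_simp.
Qed.

(** The factor [expR (l * (T - s))] equals [expR (l * (T - t))] times [expR (- (l * (s - t)))]; the
    first leaves the integral and the substitution [u = s - t] turns the rest into [weight]. So the
    exponential norm at time [t] is reproduced with [weight] as its factor. *)
Lemma weight_shift (A l t r : R) : 0 <= l -> 0 <= t -> t <= r -> r <= T ->
  mu.-integrable `]t, r[
    (EFin \o (fun s => w (s - t) * (A * expR (l * (T - s))))) /\
  \int[mu]_(s in `]t, r[) (w (s - t) * (A * expR (l * (T - s)))) =
    A * expR (l * (T - t)) * weight l (r - t).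
Proof.
move=> l0 t0 tr rT; have rtT : r - t <= T by lra.
have Dt : [set s | `]0, r - t[%classic (s - t)] = `]t, r[%classic.
  by apply/seteqP; split=> s /=; rewrite !in_itv /= subr_gt0 ltrD2r.
have [||i E] := @integrable_shift t `]0, r - t[ _ _ (integrable_weight l0 rtT).
- by [].
- move=> u /=; rewrite in_itv /= => /andP[u0 ur].
  by have /andP[] := weight_bound l0 u0 (ltW (lt_le_trans ur rtT)).
rewrite Dt in i E.
have F s : w (s - t) * (A * expR (l * (T - s))) =
    A * expR (l * (T - t)) * (w (s - t) * expR (- (l * (s - t)))).
  rewrite (_ : l * (T - s) = l * (T - t) - l * (s - t)); last by ring.
  by rewrite expRD; ring.
split.
  apply: eq_integrable (integrableZl _ (A * expR (l * (T - t))) i) => // s _ /=.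
  by rewrite F.
under eq_Rintegral do rewrite F.
set c := A * expR _; have := @RintegralZl _ _ _ mu _ _ c (measurable_itv _) i.
by move=> ->; congr (_ * _); exact: E.
Qed.

Lemma weight_ge0 l a : 0 <= l -> a <= T -> 0 <= weight l a.
Proof.
move=> l0 aT; apply: Rintegral_ge0 => u /=; rewrite in_itv /= => /andP[u0 ua].
by have /andP[] := weight_bound l0 u0 (ltW (lt_le_trans ua aT)).
Qed.

Lemma weight_mono l a b : 0 <= l -> 0 <= a -> a <= b -> b <= T ->
  weight l a <= weight l b.
Proof.
move=> l0 a0; rewrite le_eqVlt => /orP[/eqP->//|ab] bT.
rewrite /weight -subr_ge0.
have ib := integrable_weight l0 bT.
have ia := integrable_weight l0 (le_trans (ltW ab) bT).
rewrite (Rintegral_itv_bndo_bndc ia) Rintegral_itvB ?bnd_simp//.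
apply: Rintegral_ge0 => u /=; rewrite in_itv /= => /andP[au ub].
by have /andP[] := weight_bound l0 (le_lt_trans a0 au) (ltW (lt_le_trans ub bT)).
Qed.

(** Dominated convergence for the restrictions of [w] to []0, T/(n+1)[]; this makes short Duhamel
    integrals small. *)
Lemma weight_small e : 0 < e -> exists a, [/\ 0 < a, a <= T & weight 0 a < e].
Proof.
move=> e0; pose f u := w u * expR (- (0 * u)).
pose a n := T / n.+1%:R.
have a0 n : 0 < a n by rewrite divr_gt0.
have aT n : a n <= T by rewrite ler_pdivrMr// ler_peMr// ?ler1n// ltW.
have aE n : weight 0 (a n) = \int[mu]_(u in `]0, T[) (f \_ `]0, a n[) u.
  rewrite /weight -Rintegral_mkcondr; congr (Rintegral _ _ _).
  apply/seteqP; split=> u /=; rewrite !in_itv /=; last by case.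
  by move=> /andP[u0 ua]; rewrite u0 (lt_le_trans ua (aT n)) ua.
have [| | | |_] := @Rintegral_dominated_cvg _ _ _ mu `]0, T[ w _ iwT
  (fun n => f \_ `]0, a n[) (cst 0) => //.
- move=> n; apply/(measurable_restrict _ _ _).1 => //.
  by apply: measurable_funS (measurable_weight 0) => //; exact: subIsetl.
- move=> u /=; rewrite in_itv /= => /andP[u0 uT].
  (* Once [1/(n0+1) < u/T], the shrinking interval no longer contains [u]. *)
  apply: cvg_near_cst; have [n0 n0u] := invn_lt (divr_gt0 u0 T0).
  exists n0 => // n /= n0n; rewrite patchE ifF//; apply/negbTE.
  rewrite notin_setE /= in_itv /= u0 /= => ua; move: n0u.
  rewrite ltNge => /negP; apply; rewrite ler_pdivrMr// mulrC.
  apply: le_trans (ltW ua) _; rewrite /a ler_pM2l// lef_pV2 ?posrE//.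
  by rewrite ler_nat.
- move=> n u /=; rewrite in_itv /= => /andP[u0 uT].
  have /andP[wp ww] := weight_bound (lexx 0) u0 (ltW uT).
  rewrite patchE; case: ifP => _; first by rewrite ger0_norm.
  by rewrite normr0 (le_trans wp).
rewrite Rintegral_cst// mul0r => /cvgrPdist_lt/(_ _ e0)[n _ /(_ n (leqnn _))].
rewrite sub0r normrN -aE => H; exists (a n); split=> //.
exact: le_lt_trans (ler_norm _) H.
Qed.

(** For every [u > 0] the factor [expR (- (n * u))] tends to 0 while [w] dominates; this supplies
    the rate at which the Picard map contracts. *)
Lemma weight_large e : 0 < e -> exists2 l, 0 <= l & weight l T < e.
Proof.
move=> e0; have [| | | |_] := @Rintegral_dominated_cvg _ _ _ mu `]0, T[ w _ iwT
  (fun n u => w u * expR (- (n%:R * u))) (cst 0) => //.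
- by move=> n; exact: measurable_weight.
- move=> u /=; rewrite in_itv /= => /andP[u0 uT].
  apply/cvgrPdist_lt => r r0; have wu := w0 (ltW u0) (ltW uT).
  have [n0 n0r] := invn_lt (divr_gt0 (mulr_gt0 r0 u0) wu).
  exists n0.+1 => // n /= n0n; rewrite sub0r normrN ger0_norm; last first.
    by rewrite mulr_ge0 ?expR_ge0// ltW.
  have nu : 0 < n%:R * u by rewrite mulr_gt0// ltr0n (leq_trans _ n0n).
  rewrite expRN ltr_pdivrMr ?expR_gt0//.
  (* The inequality [expR y >= 1 + y > y] reduces the claim to [w u < r * n * u]. *)
  apply: (@lt_trans _ _ (r * (n%:R * u))); last first.
    by rewrite ltr_pM2l//; have := expR_ge1Dx (n%:R * u); lra.
  have h : w u < r * u * n0.+1%:R.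
    by rewrite -ltr_pdivrMr// mulrC -ltr_pdivlMr.
  apply: lt_le_trans h _.
  by rewrite (mulrC n%:R) mulrA ler_pM2l ?mulr_gt0// ler_nat.
- move=> n u /=; rewrite in_itv /= => /andP[u0 uT].
  have /andP[wp ww] := weight_bound (ler0n _ n) u0 (ltW uT).
  by rewrite ger0_norm.
rewrite Rintegral_cst// mul0r => /cvgrPdist_lt/(_ _ e0)[n _ /(_ n (leqnn _))].
rewrite sub0r normrN => H; exists n%:R => //.
exact: le_lt_trans (ler_norm _) H.
Qed.

End Weights.

(** * Curves in C1 *)

Section Curves.
Context {R : realType} {d : nat}.

Lemma within_continuous_epsP (A : set R) (f : R -> R) :
  {within A, continuous f} <->
  forall t, A t -> forall e, 0 < e -> exists2 r : R, 0 < r &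
    forall s, A s -> `|s - t| < r -> `|f s - f t| < e.
Proof.
split=> [/subspace_continuousP cf t At e e0|cf].
  have /cvgrPdist_lt/(_ e e0) := cf t At; rewrite near_withinE.
  move=> /nbhs_ballP[r r0 rf]; exists r => // s As st; rewrite distrC.
  by apply: rf => //; rewrite -ball_normE /= distrC.
apply/subspace_continuousP => t At; apply/cvgrPdist_lt => e e0.
have [r r0 rf] := cf t At e e0; rewrite near_withinE.
apply/nbhs_ballP; exists r => // s; rewrite -ball_normE /= => ts As.
by rewrite distrC rf// distrC.
Qed.

Lemma curve_continuous_eps {E : Type} {S : pseudoMetricType R}
  (N : (E -> R) -> R) (A : set S) (F : S -> E -> R) : curve_continuous N A F ->
  forall s, A s -> forall e, 0 < e -> exists2 r : R, 0 < r &
    forall s', A s' -> ball s r s' -> `|N (F s' - F s)| < e.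
Proof.
move=> cF s As e e0; have /cvgrPdist_lt/(_ e e0) := cF s As.
rewrite near_withinE => /nbhs_ballP[r r0 rf]; exists r => // s' As' ss'.
by have := rf _ ss' As'; rewrite sub0r normrN.
Qed.

Lemma curve_continuousP {E : Type} (N : (E -> R) -> R) (A : set R)
  (F : R -> E -> R) :
  (forall t, A t -> forall e, 0 < e -> exists2 r : R, 0 < r &
    forall s, A s -> `|s - t| < r -> `|N (F s - F t)| < e) ->
  curve_continuous N A F.
Proof.
move=> cF t At; apply/cvgrPdist_lt => e e0.
have [r r0 rf] := cF t At e e0; rewrite near_withinE.
apply/nbhs_ballP; exists r => // s; rewrite -ball_normE /= => ts As.
by rewrite sub0r normrN rf// distrC.
Qed.

Implicit Types f g : 'rV[R]_d -> R.

Lemma rowB_coord (u v : 'rV[R]_d) i :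
  (u - v) ord0 i = u ord0 i - v ord0 i.
Proof. by rewrite !mxE. Qed.

(** A coordinatewise substitute for a bound on [C1norm], equivalent to it on [C1inf] up to the
    factor [1 + d], and additive without any [sup]. *)
Definition C1_bound f (b : R) :=
  (forall x, `|f x| <= b) /\ (forall x i, `|grad f x ord0 i| <= b).

Lemma C1_bound_C1norm f : C1inf f -> C1_bound f (C1norm f).
Proof. by move=> Cf; split=> *; [exact: le_C1norm|exact: grad_le_C1norm]. Qed.

Lemma C1norm_le_bound f (b : R) : C1_bound f b -> C1norm f <= (1 + d%:R) * b.
Proof. by move=> [fb gb]; rewrite mulrDl mul1r; exact: C1norm_le. Qed.

Lemma C1_boundD f g (a b : R) : C1inf f -> C1inf g -> C1_bound f a ->
  C1_bound g b -> C1_bound (fun x => f x + g x) (a + b).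
Proof.
move=> [_ df _] [_ dg _] [fa gfa] [gb ggb]; split=> [x|x i].
  by apply: le_trans (ler_normD _ _) _; exact: lerD.
have [_] := grad_lin 1 (df x) (dg x).
rewrite (_ : (fun y => 1 * f y + g y) = (fun y => f y + g y)); last first.
  by apply/funext => y; rewrite mul1r.
move=> ->; rewrite mxE mxE mul1r.
by apply: le_trans (ler_normD _ _) _; exact: lerD.
Qed.

Lemma C1_boundB f g (a b : R) : C1inf f -> C1inf g -> C1_bound f a ->
  C1_bound g b -> C1_bound (f - g) (a + b).
Proof.
move=> Cf Cg [fa gfa] [gb ggb]; have [_ gE] := C1inf_sub Cf Cg.
split=> [x|x i]; first by apply: le_trans (ler_normB _ _) _; exact: lerD.
by rewrite gE rowB_coord; apply: le_trans (ler_normB _ _) _; exact: lerD.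
Qed.

(** Near each [t0] the gradient is at most [C1norm (V t0) + 1]; compactness of [[0, T]], with the
    filter of large [M], makes the bound uniform. *)
Lemma C1_curve_bounded (T : R) (V : R -> 'rV[R]_d -> R) :
  (forall t, 0 <= t -> t <= T -> C1inf (V t)) ->
  curve_continuous C1norm `[0, T] V ->
  exists M, forall t x i, 0 <= t -> t <= T -> `|grad (V t) x ord0 i| <= M.
Proof.
move=> CV cV.
have /compact_near_coveringP/near_covering_withinP K := @segment_compact R 0 T.
have := K R +oo%R (fun M t => forall x i, `|grad (V t) x ord0 i| <= M) _.
case.
- move=> t0 /=; rewrite in_itv /= => /andP[t00 t0T].
  have At0 : `[0, T]%classic t0 by rewrite /= in_itv /= t00.
  have [r r0 rV] := curve_continuous_eps cV At0 ltr01.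
  exists (ball t0 r, [set M | C1norm (V t0) + 1 < M]); first split.
  + exact: nbhsx_ballx.
  + exact: nbhs_pinfty_gt (num_real _).
  move=> [t M] /= [tr MM] tI x i.
  have [tt0 tT] : 0 <= t /\ t <= T by move: tI; rewrite in_itv /= => /andP[].
  have [C gE] := C1inf_sub (CV _ tt0 tT) (CV _ t00 t0T).
  have ab := grad_le_C1norm x i C; rewrite gE rowB_coord in ab.
  have c1 := le_trans (ler_norm _) (ltW (rV t tI tr)).
  rewrite -(subrK (grad (V t0) x ord0 i) (grad (V t) x ord0 i)).
  apply: le_trans (ler_normD _ _) _; rewrite addrC; apply: le_trans (ltW MM).
  exact: lerD (grad_le_C1norm x i (CV _ t00 t0T)) (le_trans ab c1).
move=> M [Mr MV]; exists (M + 1) => t x i t00 tT.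
by apply: (MV (M + 1)) => //=; rewrite ?ltrDl// in_itv /= t00.
Qed.

End Curves.

(** * Geometrically convergent sequences *)

Section GeometricLimits.
Context {R : realType}.

(** Nested intervals: [u n + 2C/2^n] decreases, [u n - 2C/2^n] increases, and the supremum of the
    latter lies between them for every [n]. *)
Lemma geometric_limit (u : nat -> R) (C : R) :
  (forall n, `|u n.+1 - u n| <= C / 2 ^+ n) ->
  exists l, forall n, `|u n - l| <= 2 * C / 2 ^+ n.
Proof.
move=> uC; pose a n := u n + 2 * C / 2 ^+ n; pose b n := u n - 2 * C / 2 ^+ n.
have E n : 2 * C / 2 ^+ n.+1 = C / 2 ^+ n.
  by rewrite exprS; field; rewrite expf_neq0.
have aS n : a n.+1 <= a n.
  by rewrite /a E; have := uC n; rewrite ler_norml -mulrA => /andP[]; lra.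
have bS n : b n <= b n.+1.
  by rewrite /b E; have := uC n; rewrite ler_norml -mulrA => /andP[]; lra.
have am m n : (m <= n)%N -> a n <= a m.
  by move=> /subnK <-; elim: (n - m)%N => // k IH; apply: le_trans (aS _) IH.
have bm m n : (m <= n)%N -> b m <= b n.
  by move=> /subnK <-; elim: (n - m)%N => // k IH; apply: le_trans IH (bS _).
have C0 : 0 <= C by have := le_trans (normr_ge0 _) (uC 0%N); rewrite expr0 divr1.
have ba n m : b n <= a m.
  apply: le_trans (bm _ _ (leq_maxl n m)) _.
  apply: le_trans _ (am _ _ (leq_maxr n m)).
  have : 0 <= 2 * C / 2 ^+ maxn n m by rewrite divr_ge0// ?mulr_ge0// exprn_ge0.
  by rewrite /a /b; lra.
exists (sup (range b)) => n; rewrite ler_distl.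
have bl : b n <= sup (range b).
  by apply: ub_le_sup; [exists (a 0%N) => _ [k _ <-]|exists n].
have la : sup (range b) <= a n.
  by apply: ge_sup; [exists (b 0%N), 0%N|move=> _ [k _ <-]].
by move: bl la; rewrite /a /b; lra.
Qed.

Lemma pow2_small (C e : R) : 0 < e -> exists n0, forall n, (n0 <= n)%N ->
  C / 2 ^+ n < e.
Proof.
move=> e0; exists (Num.truncn (`|C| / e)).+1 => n n0n.
rewrite ltr_pdivrMr ?exprn_gt0// mulrC -ltr_pdivrMr//.
apply: (@le_lt_trans _ _ (`|C| / e)); first by rewrite ler_pM2r ?invr_gt0// ler_norm.
apply: lt_trans (Num.Theory.truncnS_gt _) _.
by rewrite -natrX ltr_nat (leq_ltn_trans n0n)// ltn_expl.
Qed.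

Lemma le_pow2_eq0 (a C : R) : (forall n, `|a| <= C / 2 ^+ n) -> a = 0.
Proof.
move=> aC; apply/eqP; rewrite -normr_eq0 eq_le normr_ge0 andbT.
apply/ler_addgt0Pl => e e0; rewrite addr0.
have [n Hn] := pow2_small C e0; apply: le_trans (aC n) _.
exact: ltW (Hn n (leqnn n)).
Qed.

End GeometricLimits.

(** * The mild equation *)

Section Duhamel.
Context {R : realType} {d : nat}.
Notation mu := (@lebesgue_measure R).
Let E := 'rV[R]_d.
Variables (T c2 : R) (U : R -> R -> (E -> R) -> (E -> R)) (w : R -> R).
Hypothesis T0 : 0 < T.
Hypothesis propU : backward_propagator T Cinf supnorm U.
Hypothesis contU : strongly_continuous T Cinf supnorm U.
Hypothesis C1U : forall t s f, 0 <= t -> t <= s -> s <= T -> C1inf f ->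
  C1inf (U t s f).
Hypothesis contC1U : strongly_continuous T C1inf C1norm U.
Hypothesis c20 : 0 < c2.
Hypothesis normU : forall t s f, 0 <= t -> t <= s -> s <= T -> Cinf f ->
  supnorm (U t s f) <= c2 * supnorm f.
Hypothesis smoothU : forall t s f, 0 <= t -> t < s -> s <= T -> Cinf f ->
  C1inf (U t s f).
Hypothesis w0 : forall u, 0 <= u -> u <= T -> 0 < w u.
Hypothesis iw : mu.-integrable `[0, T] (EFin \o w).
Hypothesis normC1U : forall t s f, 0 <= t -> t < s -> s < T -> Cinf f ->
  C1norm (U t s f) <= w (s - t) * supnorm f.

(** Conditions under which the Duhamel integral makes sense, and which survive the uniform limit of
    the Picard iterates. *)
Definition admissible (g : R -> E -> R) :=
  [/\ forall s, 0 <= s -> s <= T -> Cinf (g s),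
      forall x, measurable_fun `[0, T] (g ^~ x) &
      exists M, forall s x, 0 <= s -> s <= T -> `|g s x| <= M].

(** The upper limit [r] stays free because the proof of continuity in time splits the integral at an
    intermediate time. *)
Definition duhamel (g : R -> E -> R) (t r : R) (x : E) : R :=
  \int[mu]_(s in `[t, r]) U t s (g s) x.

Lemma propagator_functional t s x : 0 <= t -> t <= s -> s <= T ->
  bounded_functional (fun f => U t s f x) c2.
Proof.
move=> t0 ts sT; have [UC Ulin _] := propagator_bounded propU t0 ts sT.
split=> [a f g Cf Cg|f M Cf fM]; first by rewrite Ulin.
apply: le_trans (Cinf_le_supnorm x (UC _ Cf)) _.
apply: le_trans (normU t0 ts sT Cf) _.
by rewrite ler_pM2l//; exact: supnorm_le.
Qed.

Lemma propagator_continuous f t x : Cinf f -> 0 <= t -> t <= T ->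
  {within `[t, T], continuous (fun s => U t s f x)}.
Proof.
move=> Cf t0 tT; apply/within_continuous_epsP => s /=.
rewrite in_itv /= => /andP[ts sT] e e0.
have ps : triangle T (t, s) by split.
have [r r0 rU] := curve_continuous_eps (contU Cf) ps e0.
exists r => // s' /=; rewrite in_itv /= => /andP[ts' s'T] s's.
have ps' : triangle T (t, s') by split.
have := rU (t, s') ps'; rewrite /=.
have [UC _ _] := propagator_bounded propU t0 ts sT.
have [UC' _ _] := propagator_bounded propU t0 ts' s'T.
have CB : Cinf (U t s' f - U t s f) by exact: CinfB (UC' _ Cf) (UC _ Cf).
move=> H; apply: le_lt_trans (Cinf_le_supnorm x CB) _.
apply: le_lt_trans (ler_norm _) _; apply: H.
split; first exact: ballxx.
by rewrite /= -ball_normE /= distrC.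
Qed.

Lemma sub_itv0T t r : 0 <= t -> r <= T -> `[t, r]%classic `<=` `[0, T]%classic.
Proof.
move=> t0 rT s /=; rewrite !in_itv /= => /andP[ts sr].
by rewrite (le_trans t0 ts) (le_trans sr rT).
Qed.

(** For fixed [f] the map [s |-> U t s f x] is continuous by strong continuity, hence measurable;
    interpolation then handles the varying [g s]. *)
Lemma measurable_propagated g t r x : admissible g -> 0 <= t -> r <= T ->
  measurable_fun `[t, r] (fun s => U t s (g s) x).
Proof.
move=> [Cg mg _] t0 rT; apply: (@measurable_fun_functional _ _ _ _ _
    (fun s f => U t s f x) c2).
- move=> s /=; rewrite in_itv /= => /andP[ts sr].
  by apply: propagator_functional; rewrite // (le_trans sr).
- move=> f Cf; have [tT|Tt] := lerP t T; last first.
    rewrite set_itv_ge; first exact: measurable_fun_set0.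
    by rewrite bnd_simp -ltNge (le_lt_trans rT).
  apply: (@measurable_funS _ _ _ _ `[t, T]) => //.
    by apply: subset_itvl; rewrite bnd_simp.
  apply: subspace_continuous_measurable_fun => //.
  exact: propagator_continuous.
- move=> s /=; rewrite in_itv /= => /andP[ts sr].
  by apply: Cg; [exact: le_trans ts|exact: le_trans rT].
- by move=> y; apply: measurable_funS (mg y) => //; exact: sub_itv0T.
Qed.

Lemma propagated_le g (M : R) t s x : Cinf (g s) -> (forall y, `|g s y| <= M) ->
  0 <= t -> t <= s -> s <= T -> `|U t s (g s) x| <= c2 * M.
Proof.
by move=> Cg gM t0 ts sT; have [_ bU] := propagator_functional x t0 ts sT; exact: bU.
Qed.

Lemma integrable_cst_itv (a b k : R) : mu.-integrable `[a, b] (EFin \o cst k).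
Proof.
apply: continuous_compact_integrable; first exact: segment_compact.
by apply: continuous_subspaceT => x; exact: cvg_cst.
Qed.

Lemma integrable_propagated g t r x : admissible g -> 0 <= t -> r <= T ->
  mu.-integrable `[t, r] (EFin \o (fun s => U t s (g s) x)).
Proof.
move=> ag t0 rT; have [Cg _ [M gM]] := ag.
apply: (dominated_integrable_EFin _ (integrable_cst_itv t r (c2 * M))) => //.
  exact: measurable_propagated.
move=> s /=; rewrite in_itv /= => /andP[ts sr].
have s0 := le_trans t0 ts; have sT := le_trans sr rT.
by apply: propagated_le => //; [exact: Cg|move=> y; exact: gM].
Qed.

(** Dropping the two end points, a null set, removes [s = t], where [U t t] does not smooth, and
    [s = T], where no smoothing bound is assumed. *)
Lemma duhamel_open g t r : admissible g -> 0 <= t -> r <= T ->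
  duhamel g t r = fun x => \int[mu]_(s in `]t, r[) U t s (g s) x.
Proof.
move=> ag t0 rT; apply/funext => x.
have i := integrable_propagated x ag t0 rT.
have i' : mu.-integrable `[t, r[ (EFin \o (fun s => U t s (g s) x)).
  by apply: integrableS i => //; apply: subset_itvl; rewrite bnd_simp.
rewrite /duhamel -Rintegral_itv_bndo_bndc// -Rintegral_itv_obnd_cbnd//.
by apply: integrableS i' => //; apply: subset_itvr; rewrite bnd_simp.
Qed.

(** The smoothing bound dominates [U t s (g s)] and its gradient by
    [w (s - t) * (A * expR (l * (T - s)))]. Differentiation under the integral applies, and
    [weight_shift] evaluates the integral of the bound. *)
Lemma duhamel_C1 g (A l t r : R) : admissible g ->
  (forall s x, 0 <= s -> s <= T -> `|g s x| <= A * expR (l * (T - s))) ->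
  0 <= l -> 0 <= t -> t <= r -> r <= T ->
  C1inf (duhamel g t r) /\
  C1_bound (duhamel g t r) (A * expR (l * (T - t)) * weight w l (r - t)).
Proof.
move=> ag gA l0 t0 tr rT; have [Cg _ _] := ag.
have [iW EW] := weight_shift w0 iw A l0 t0 tr rT.
rewrite duhamel_open// -EW.
set W := fun s => w (s - t) * (A * expR (l * (T - s))).
have itvP s : `]t, r[%classic s -> [/\ t < s, s < T, 0 <= s & s <= T].
  rewrite /= in_itv /= => /andP[ts sr]; have sT := lt_le_trans sr rT.
  by split=> //; [exact: le_trans (ltW ts)|exact: ltW].
have UW s : `]t, r[%classic s -> C1norm (U t s (g s)) <= W s.
  move=> /itvP[ts sT s0 sT']; apply: le_trans (normC1U t0 ts sT (Cg _ s0 sT')) _.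
  rewrite /W ler_pM2l; last by apply: w0; lra.
  by apply: supnorm_le => x; exact: gA.
have CU s : `]t, r[%classic s -> C1inf (U t s (g s)).
  by move=> /itvP[ts sT s0 sT']; apply: smoothU => //; exact: Cg.
have mU x : measurable_fun `]t, r[ (fun s => U t s (g s) x).
  apply: measurable_funS (measurable_propagated x ag t0 rT) => //.
  by apply: subset_itv; rewrite bnd_simp.
have Ub s x : `]t, r[%classic s -> `|U t s (g s) x| <= W s.
  by move=> Is; apply: le_trans (le_C1norm x (CU s Is)) (UW s Is).
have gUb s x i : `]t, r[%classic s -> `|grad (U t s (g s)) x ord0 i| <= W s.
  by move=> Is; apply: le_trans (grad_le_C1norm x i (CU s Is)) (UW s Is).
have mI : measurable (`]t, r[%classic : set R) by [].
pose UG s := U t s (g s).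
have F1 := @C1inf_Rintegral _ _ R d mu `]t, r[%classic W UG mI iW mU Ub CU gUb.
have F2 := @grad_Rintegral _ _ R d mu `]t, r[%classic W UG mI iW mU Ub CU gUb.
have D := @dominated_Rintegral_le _ _ R mu `]t, r[%classic W mI iW.
split; first exact: F1.
split=> [x|x i].
  by apply: (D _ (mU x)) => s; exact: Ub.
have [_ ->] := F2 x; rewrite mxE.
apply: D => [|s]; last exact: gUb.
exact: (@measurable_fun_grad _ _ R d `]t, r[%classic UG mU CU).
Qed.

(** A uniform bound is recast as the weighted bound with rate 0, the form in which [duhamel_C1]
    accepts it. *)
Lemma admissible_bound0 g : admissible g -> exists2 M, 0 <= M &
  forall s x, 0 <= s -> s <= T -> `|g s x| <= M * expR (0 * (T - s)).
Proof.
move=> [_ _ [M gM]]; exists M; first by exact: le_trans (gM 0 0 _ (ltW T0)).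
by move=> s x s0 sT; rewrite mul0r expR0 mulr1 gM.
Qed.

(** For [s >= r] the propagator factors as [U t r] after [U r s], and evaluation of [U t r] at [x]
    is a bounded functional, which commutes with the integral. *)
Lemma duhamel_split g t r x : admissible g -> 0 <= t -> t <= r -> r <= T ->
  duhamel g t T x = duhamel g t r x + U t r (duhamel g r T) x.
Proof.
move=> ag t0 tr rT; have [Cg mg [M gM]] := ag; have r0 := le_trans t0 tr.
have i := integrable_propagated x ag t0 (lexx T).
have itvP s : `[r, T]%classic s -> [/\ r <= s, s <= T & 0 <= s].
  by rewrite /= in_itv /= => /andP[rs sT]; split=> //; exact: le_trans rs.
have -> : U t r (duhamel g r T) x = \int[mu]_(s in `[r, T]) U t s (g s) x.
  rewrite (@bounded_functional_Rintegral _ _ _ _ mu `[r, T] (cst (c2 * M))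
    (fun f => U t r f x) c2 (fun s => U r s (g s))) //.
  - apply: eq_Rintegral => s; rewrite inE => /itvP[rs sT s0].
    by rewrite (propagator_comp propU)//; exact: Cg.
  - exact: integrable_cst_itv.
  - exact: propagator_functional.
  - move=> s /itvP[rs sT s0]; have [UC _ _] := propagator_bounded propU r0 rs sT.
    by apply: UC; exact: Cg.
  - by move=> y; exact: measurable_propagated.
  - move=> s y /itvP[rs sT s0]; apply: propagated_le => //; first exact: Cg.
    by move=> z; exact: gM.
rewrite -Rintegral_itv_obnd_cbnd; last first.
  apply: integrableS i => //; apply: subset_itvr.
  by rewrite bnd_simp.
by rewrite -(@Rintegral_itvB _ _ (BLeft t) _ r i) ?bnd_simp// addrC subrK.
Qed.

Lemma duhamelB g g' t x : admissible g -> admissible g' -> 0 <= t -> t <= T ->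
  duhamel (fun s y => g s y - g' s y) t T x = duhamel g t T x - duhamel g' t T x.
Proof.
move=> ag ag' t0 tT; rewrite /duhamel -RintegralB//;
  [|exact: integrable_propagated..].
have [[Cg _ _] [Cg' _ _]] := (ag, ag').
apply: eq_Rintegral => s; rewrite inE /= in_itv /= => /andP[ts sT].
have s0 := le_trans t0 ts.
have [Ul _] := propagator_functional x t0 ts sT.
have := Ul (-1) _ _ (Cg' s s0 sT) (Cg s s0 sT); rewrite mulN1r addrC => <-.
by congr (U t s _ x); apply/funext => y; rewrite mulN1r addrC.
Qed.

Lemma admissibleB g g' : admissible g -> admissible g' ->
  admissible (fun s y => g s y - g' s y).
Proof.
move=> [Cg mg [M gM]] [Cg' mg' [M' gM']]; split=> [s s0 sT|x|].
- by apply: CinfB; [exact: Cg|exact: Cg'].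
- exact: measurable_funB.
- exists (M + M') => s x s0 sT; apply: le_trans (ler_normB _ _) _.
  by apply: lerD; [exact: gM|exact: gM'].
Qed.

(** * The mild map and its continuity in time *)

Variable VT : E -> R.
Hypothesis C1VT : C1inf VT.

Definition mild_map (g : R -> E -> R) (t : R) (x : E) : R :=
  U t T VT x + duhamel g t T x.

Lemma C1inf_mild_map g t : admissible g -> 0 <= t -> t <= T ->
  C1inf (mild_map g t).
Proof.
move=> ag t0 tT; have [M M0 gM] := admissible_bound0 ag.
have [CJ _] := duhamel_C1 ag gM (lexx 0) t0 tT (lexx T).
have := C1inf_lin 1 (C1U t0 tT (lexx T) C1VT) CJ.
by congr C1inf; apply/funext => x; rewrite mul1r.
Qed.

(* Near [t0], [duhamel g t T] splits at a time [r] slightly later than [t0]: the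
   part before [r] is small and the part after [r] is [U t r] applied to a fixed
   function of [C1inf]. *)
Lemma mild_map_continuous g : admissible g ->
  curve_continuous C1norm `[0, T] (mild_map g).
Proof.
move=> ag; have [M M0 gM] := admissible_bound0 ag.
apply: curve_continuousP => t0 /=; rewrite in_itv /= => /andP[t00 t0T] e e0.
have d1 : 0 < 1 + d%:R :> R by rewrite ltr_wpDr.
(* The difference will have [C1_bound] equal to [4 * e']; passing to [C1norm] costs [1 + d], which
   leaves [4/5] of [e]. *)
pose e' := e / (5 * (1 + d%:R)); have e'0 : 0 < e' by rewrite divr_gt0// mulr_gt0.
(* [M] may be 0, so the division is by [M + 1]. *)
have M1 : 0 < M + 1 by rewrite ltr_wpDl.
have [a [a0 aT wa]] := weight_small T0 w0 iw (divr_gt0 e'0 M1).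
(* For [t] within [a / 2] of [t0] the length [r - t] is at most [a]; the minimum keeps [r] below
   [T]. *)
pose r := Num.min (t0 + a / 2) T.
have t0r : t0 <= r by rewrite le_min t0T andbT lerDl divr_ge0// ltW.
have rT : r <= T by rewrite ge_min lexx orbT.
have r0 := le_trans t00 t0r.
have small t : 0 <= t -> t <= r -> `|t - t0| < a / 2 ->
    C1inf (duhamel g t r) /\ C1_bound (duhamel g t r) e'.
  move=> t0' tr tt0; have [CJ [b1 b2]] := duhamel_C1 ag gM (lexx 0) t0' tr rT.
  have rta : r - t <= a.
    have : r <= t0 + a / 2 by rewrite ge_min lexx.
    by move: tt0; rewrite ltr_distl; lra.
  have le_e' : M * expR (0 * (T - t)) * weight w 0 (r - t) <= e'.
    rewrite mul0r expR0 mulr1.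
    have w1 : weight w 0 (r - t) <= weight w 0 a.
      by apply: (weight_mono w0 iw) => //; lra.
    have w2 : 0 <= weight w 0 (r - t) by apply: (weight_ge0 w0); lra.
    apply: (@le_trans _ _ ((M + 1) * (e' / (M + 1)))); last first.
      by rewrite mulrC divfK// gt_eqF.
    by apply: ler_pM => //; [lra|exact: le_trans w1 (ltW wa)].
  by split=> //; split=> *; [exact: le_trans (b1 _) _|exact: le_trans (b2 _ _) _].
have [CY _] := duhamel_C1 ag gM (lexx 0) r0 rT (lexx T).
have pr : triangle T (t0, r) by split.
have pT : triangle T (t0, T) by split=> //=.
have [q1 q10 Hq1] := curve_continuous_eps (contC1U CY) pr e'0.
have [q2 q20 Hq2] := curve_continuous_eps (contC1U C1VT) pT e'0.
exists (Num.min (a / 2) (Num.min q1 q2)).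
  by rewrite !lt_min q10 q20 divr_gt0.
move=> t /=; rewrite in_itv /= => /andP[tt0 tT].
rewrite !lt_min => /and3P[ta tq1 tq2].
have tr : t <= r.
  by rewrite le_min tT andbT; move: ta; rewrite ltr_distl; lra.
have [CJ JB] := small t tt0 tr ta.
have [|CJ0 JB0] := small t0 t00 t0r; first by rewrite subrr normr0 divr_gt0.
have CUY := C1U tt0 tr rT CY; have CUY0 := C1U t00 t0r rT CY.
have CUV := C1U tt0 tT (lexx T) C1VT; have CUV0 := C1U t00 t0T (lexx T) C1VT.
have bb (q u v v' : R) : `|u - v| < q -> ball (v, v') q (u, v').
  move=> uv; split; last by apply: ballxx; apply: le_lt_trans uv.
  by rewrite /= -ball_normE /= distrC.
have B1 : C1_bound (U t r (duhamel g r T) - U t0 r (duhamel g r T)) e'.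
  have [b1 b2] := C1_bound_C1norm (C1inf_sub CUY CUY0).1.
  have := Hq1 (t, r) (And3 tt0 tr rT) (bb _ _ _ _ tq1).
  move=> /ltW/(le_trans (ler_norm _)) h.
  by split=> *; [exact: le_trans (b1 _) h|exact: le_trans (b2 _ _) h].
have B2 : C1_bound (U t T VT - U t0 T VT) e'.
  have [b1 b2] := C1_bound_C1norm (C1inf_sub CUV CUV0).1.
  have := Hq2 (t, T) (And3 tt0 tT (lexx T)) (bb _ _ _ _ tq2).
  move=> /ltW/(le_trans (ler_norm _)) h.
  by split=> *; [exact: le_trans (b1 _) h|exact: le_trans (b2 _ _) h].
have -> : mild_map g t - mild_map g t0 = fun x =>
    (U t r (duhamel g r T) - U t0 r (duhamel g r T)) x +
    ((U t T VT - U t0 T VT) x + (duhamel g t r - duhamel g t0 r) x).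
  apply/funext => x.
  change (U t T VT x + duhamel g t T x - (U t0 T VT x + duhamel g t0 T x) =
    (U t r (duhamel g r T) x - U t0 r (duhamel g r T) x) +
    ((U t T VT x - U t0 T VT x) + (duhamel g t r x - duhamel g t0 r x))).
  by rewrite (duhamel_split x ag tt0 tr rT) (duhamel_split x ag t00 t0r rT); ring.
have C3 := (C1inf_sub CJ CJ0).1; have C2 := (C1inf_sub CUV CUV0).1.
have C1 := (C1inf_sub CUY CUY0).1.
have C23 : C1inf (fun x => (U t T VT - U t0 T VT) x +
    (duhamel g t r - duhamel g t0 r) x).
  have := C1inf_lin 1 C2 C3.
  by congr C1inf; apply/funext => x; rewrite mul1r.
have B := C1_boundD C1 C23 B1 (C1_boundD C2 C3 B2 (C1_boundB CJ CJ0 JB JB0)).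
rewrite ger0_norm ?C1norm_ge0//.
apply: le_lt_trans (C1norm_le_bound B) _.
rewrite (_ : e' + _ = 4 * e'); last by ring.
rewrite /e' (_ : _ * (_ * _) = e * (4 / 5)); last by field; rewrite gt_eqF.
by rewrite gtr_pMr//; lra.
Qed.

(** * The fixed-point equation for the source *)

Variables (H : R -> E -> E -> R) (c1 h : R).
Hypothesis contH : forall x p, {within `[0, T], continuous (fun t => H t x p)}.
Hypothesis c10 : 0 < c1.
Hypothesis lipH : forall t x p p', 0 <= t -> t <= T ->
  `|H t x p - H t x p'| <= c1 * euclid (p - p').
Hypothesis boundH : forall t x, 0 <= t -> t <= T -> `|H t x 0| <= h.
Hypothesis CinfH : forall t f, 0 <= t -> t <= T -> C1inf f ->
  Cinf (fun x => H t x (grad f x)).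

(** For fixed [x] the source is continuous in time: [H] varies continuously at a frozen gradient,
    and the change of gradient is controlled by the Lipschitz bound. The lemma serves both the
    Picard iterates and an arbitrary solution. *)
Lemma admissible_source (V : R -> E -> R) :
  (forall t, 0 <= t -> t <= T -> C1inf (V t)) ->
  curve_continuous C1norm `[0, T] V ->
  admissible (fun t x => H t x (grad (V t) x)).
Proof.
move=> CV cV; split=> [s s0 sT|x|].
- by apply: CinfH => //; exact: CV.
- apply: subspace_continuous_measurable_fun => //.
  apply/within_continuous_epsP => t It e e0.
  have := It; rewrite /= in_itv /= => /andP[t0 tT].
  have e20 : 0 < e / 2 by rewrite divr_gt0.
  have [r1 r10 Hr1] :=
    (within_continuous_epsP _ _).1 (@contH x (grad (V t) x)) t It _ e20.
  have [r2 r20 Hr2] := curve_continuous_eps cV It (divr_gt0 e20 c10).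
  exists (Num.min r1 r2); first by rewrite lt_min r10.
  move=> s Is; rewrite lt_min => /andP[sr1 sr2].
  have := Is; rewrite /= in_itv /= => /andP[s0 sT].
  have Bst : ball t r2 s by rewrite -ball_normE /= distrC.
  have [CD gE] := C1inf_sub (CV s s0 sT) (CV t t0 tT).
  have h1 := Hr1 s Is sr1.
  have h2 : `|H s x (grad (V s) x) - H s x (grad (V t) x)| < e / 2.
    apply: le_lt_trans (lipH _ _ _ s0 sT) _; rewrite mulrC -ltr_pdivlMr// -gE.
    apply: le_lt_trans (euclid_grad_le_C1norm x CD) _.
    exact: le_lt_trans (ler_norm _) (Hr2 s Is Bst).
  rewrite -(subrKA (H s x (grad (V t) x))).
  apply: le_lt_trans (ler_normD _ _) _; rewrite (splitr e); exact: ltrD.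
- have [M gM] := C1_curve_bounded CV cV.
  exists (c1 * (d%:R * M) + h) => s x s0 sT.
  rewrite -(subrK (H s x 0) (H s x _)); apply: le_trans (ler_normD _ _) _.
  apply: lerD; last exact: boundH.
  apply: le_trans (lipH _ _ _ s0 sT) _; rewrite subr0 ler_pM2l//.
  by apply: euclid_le_bound => i; exact: gM.
Qed.

Definition source_map (g : R -> E -> R) (t : R) (x : E) : R :=
  H t x (grad (mild_map g t) x).

Lemma admissible_source_map g : admissible g -> admissible (source_map g).
Proof.
move=> ag; apply: admissible_source; last exact: mild_map_continuous.
by move=> t t0 tT; exact: C1inf_mild_map.
Qed.

(** The terminal terms cancel, so the mild maps differ by the Duhamel integral of [g - g'], whose
    partial derivatives [duhamel_C1] bounds. The Lipschitz constant and the passage from coordinates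
    to [euclid] contribute [c1 * d]. *)
Lemma source_map_contraction g g' (A l : R) :
  admissible g -> admissible g' -> 0 <= l ->
  c1 * d%:R * weight w l T <= 1 / 2 ->
  (forall s x, 0 <= s -> s <= T ->
    `|g s x - g' s x| <= A * expR (l * (T - s))) ->
  forall s x, 0 <= s -> s <= T ->
    `|source_map g s x - source_map g' s x| <= A / 2 * expR (l * (T - s)).
Proof.
move=> ag ag' l0 lsmall gA t x t0 tT.
(* The hypothesis at [s = T], where the exponential is 1. *)
have A0 : 0 <= A.
  have := le_trans (normr_ge0 _) (gA T 0 (ltW T0) (lexx T)).
  by rewrite subrr mulr0 expR0 mulr1.
have [CJ [_ JB]] := duhamel_C1 (admissibleB ag ag') gA l0 t0 tT (lexx T).
have [_ gE] := C1inf_sub (C1inf_mild_map ag t0 tT) (C1inf_mild_map ag' t0 tT).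
have DE : mild_map g t - mild_map g' t =
    duhamel (fun s y => g s y - g' s y) t T.
  apply/funext => y; rewrite (duhamelB y ag ag' t0 tT).
  change (U t T VT y + duhamel g t T y - (U t T VT y + duhamel g' t T y) =
    duhamel g t T y - duhamel g' t T y).
  by ring.
rewrite /source_map; apply: le_trans (lipH _ _ _ t0 tT) _.
rewrite -gE DE.
apply: (@le_trans _ _ (c1 * (d%:R * (A * expR (l * (T - t)) * weight w l T)))).
  rewrite ler_pM2l//; apply: euclid_le_bound => i; apply: le_trans (JB x i) _.
  rewrite ler_wpM2l ?mulr_ge0 ?expR_ge0//.
  by apply: (weight_mono w0 iw) => //; lra.
rewrite (_ : c1 * _ =
  c1 * d%:R * weight w l T * (A * expR (l * (T - t)))); last by ring.
rewrite (_ : A / 2 * _ = 1 / 2 * (A * expR (l * (T - t)))); last by field.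
by rewrite ler_wpM2r// mulr_ge0// expR_ge0.
Qed.

Lemma contraction_rate :
  exists2 l, 0 <= l & c1 * d%:R * weight w l T <= 1 / 2.
Proof.
(* The summand 1 keeps the denominator positive when [d = 0]. *)
have k0 : 0 < 2 * (c1 * d%:R + 1).
  by rewrite mulr_gt0// ltr_wpDl// mulr_ge0// ltW.
have [l l0 lw] := weight_large w0 iw (divr_gt0 ltr01 k0).
exists l => //.
have p0 : 0 <= c1 * d%:R by rewrite mulr_ge0// ltW.
apply: (@le_trans _ _ ((c1 * d%:R + 1) * (1 / (2 * (c1 * d%:R + 1))))).
  by apply: ler_pM; rewrite ?lerDl// ?(ltW lw)//; exact: (weight_ge0 w0).
by rewrite le_eqVlt; apply/orP; left; apply/eqP; field; lra.
Qed.

Lemma admissible_limit (g_ : nat -> R -> E -> R) (g : R -> E -> R) (C : R) :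
  (forall n, admissible (g_ n)) ->
  (forall n s x, 0 <= s -> s <= T -> `|g_ n s x - g s x| <= C / 2 ^+ n) ->
  admissible g.
Proof.
move=> ag_ gC; split=> [s s0 sT|x|].
- apply: Cinf_unif_closed => e e0; have [n Hn] := pow2_small C e0.
  exists (g_ n s); first by have [+ _ _] := ag_ n; exact.
  by move=> x; rewrite distrC; apply: le_trans (gC n s x s0 sT) (ltW (Hn n _)).
- apply: (@measurable_fun_cvg _ _ _ _ (fun n s => g_ n s x)).
    by move=> n; have [] := ag_ n.
  move=> s; rewrite /= in_itv /= => /andP[s0 sT]; apply/cvgrPdist_lt => e e0.
  have [n0 Hn] := pow2_small C e0; exists n0 => // n /= n0n.
  by rewrite distrC; apply: le_lt_trans (gC n s x s0 sT) (Hn n n0n).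
- have [_ _ [M gM]] := ag_ 0%N; exists (M + C) => s x s0 sT.
  have -> : g s x = g_ 0%N s x - (g_ 0%N s x - g s x) by ring.
  apply: le_trans (ler_normB _ _) _; apply: lerD; first exact: gM.
  by have := gC 0%N s x s0 sT; rewrite expr0 divr1.
Qed.

Lemma admissible0 : admissible (fun _ _ => 0).
Proof.
split=> [s _ _|x|]; [exact: Cinf0|exact: measurable_cst|].
by exists 0 => *; rewrite normr0.
Qed.

(** Picard iteration from the zero source: successive differences halve in the weighted norm, so the
    iterates converge geometrically, uniformly on [[0, T]]. *)
Lemma source_map_fixpoint : exists2 g, admissible g &
  forall s x, 0 <= s -> s <= T -> source_map g s x = g s x.
Proof.
have [l l0 lw] := contraction_rate.
pose g_ n := iter n source_map (fun _ _ => 0).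
have ag_ n : admissible (g_ n).
  by elim: n => [|n IH]; [exact: admissible0|exact: admissible_source_map].
have [_ _ [M gM]] := ag_ 1%N.
have M0 : 0 <= M by apply: le_trans (gM 0 0 _ (ltW T0)).
have step n s x : 0 <= s -> s <= T ->
    `|g_ n.+1 s x - g_ n s x| <= M / 2 ^+ n * expR (l * (T - s)).
  elim: n s x => [|n IH] s x s0 sT.
    rewrite expr0 divr1 subr0; apply: le_trans (gM s x s0 sT) _.
    by rewrite ler_peMr// -expR0 ler_expR mulr_ge0// subr_ge0.
  have := source_map_contraction (ag_ n.+1) (ag_ n) l0 lw IH x s0 sT.
  by rewrite exprS invfM mulrA [M / 2 / _]mulrAC.
have [g gl] : exists g : R -> E -> R, forall n s x, 0 <= s -> s <= T ->
    `|g_ n s x - g s x| <= 2 * (M * expR (l * (T - s))) / 2 ^+ n.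
  (* The limit is chosen at each pair of time and point; outside [[0, T]] its value is arbitrary. *)
  have /choice[g Hg] : forall p : R * E, exists v, 0 <= p.1 -> p.1 <= T ->
      forall n, `|g_ n p.1 p.2 - v| <= 2 * (M * expR (l * (T - p.1))) / 2 ^+ n.
    move=> [s x] /=; have [/andP[s0 sT]|sn] := boolP (0 <= s <= T); last first.
      by exists 0 => s0 sT; rewrite s0 sT in sn.
    have [|v Hv] := @geometric_limit R (fun n => g_ n s x) (M * expR (l * (T - s))).
      by move=> n; rewrite mulrAC; exact: step.
    by exists v.
  by exists (fun s x => g (s, x)) => n s x s0 sT; exact: (Hg (s, x)).
pose C := 2 * (M * expR (l * T)).
have gC n s x : 0 <= s -> s <= T -> `|g_ n s x - g s x| <= C / 2 ^+ n.
  move=> s0 sT; apply: le_trans (gl n s x s0 sT) _.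
  rewrite ler_pM2r ?invr_gt0 ?exprn_gt0// ler_pM2l// ler_wpM2l// ler_expR.
  by rewrite ler_wpM2l//; lra.
have ag := admissible_limit ag_ gC.
exists g => // s x s0 sT; apply/eqP; rewrite -subr_eq0; apply/eqP.
apply: (@le_pow2_eq0 _ _ (2 * (M * expR (l * (T - s))))) => n.
have gl' s' y : 0 <= s' -> s' <= T ->
    `|g s' y - g_ n s' y| <= 2 * M / 2 ^+ n * expR (l * (T - s')).
  move=> s0' sT'; rewrite distrC; apply: le_trans (gl n s' y s0' sT') _.
  by rewrite (_ : 2 * M / _ * _ = 2 * (M * expR (l * (T - s'))) / 2 ^+ n)//; ring.
have h1 := source_map_contraction ag (ag_ n) l0 lw gl' x s0 sT.
have h2 := gl n.+1 s x s0 sT.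
(* The comparison passes through [source_map (g_ n)], which is [g_ n.+1]: half the error of step [n]
   plus the error of step [n + 1]. *)
rewrite -(subrKA (source_map (g_ n) s x)); apply: le_trans (ler_normD _ _) _.
apply: le_trans (lerD h1 h2) _; rewrite le_eqVlt; apply/orP; left; apply/eqP.
by rewrite exprS; field; rewrite expf_neq0.
Qed.

(** At a fixed point the source of [mild_map g] is [g] itself, so the mild equation becomes the
    definition of [mild_map]. *)
Lemma mild_solution_exists g : admissible g ->
  (forall s x, 0 <= s -> s <= T -> source_map g s x = g s x) ->
  mild_solution T U H VT (mild_map g).
Proof.
move=> ag fg.
have E1 t x s : `[t, T]%classic s -> 0 <= t ->
    mild_integrand U H (mild_map g) t s x = U t s (g s) x.
  rewrite /= in_itv /= => /andP[ts sT] t0; rewrite /mild_integrand.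
  congr (U t s _ x); apply/funext => y; apply: fg => //; exact: le_trans ts.
split.
- by move=> t t0 tT; exact: C1inf_mild_map.
- exact: mild_map_continuous.
- apply/funext => x; rewrite /mild_map (propagator_id propU) ?(ltW T0)//;
    last exact: C1inf_Cinf.
  by rewrite /duhamel set_itv1 Rintegral_set1 addr0.
- move=> t x t0 tT.
  apply: eq_integrable (integrable_propagated x ag t0 (lexx T)) => //.
  by move=> s; rewrite inE => sI /=; rewrite E1.
- move=> t x t0 tT; rewrite {1}/mild_map; congr (_ + _); apply: eq_Rintegral => s.
  by rewrite inE => sI; rewrite E1.
Qed.

(** This reduces uniqueness of solutions to uniqueness of sources: the mild equation writes a
    solution as [mild_map] of its own source. *)
Lemma mild_solution_source V' : mild_solution T U H VT V' ->
  let g' := fun s y => H s y (grad (V' s) y) in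
  [/\ admissible g',
      forall t, 0 <= t -> t <= T -> V' t = mild_map g' t &
      forall s x, 0 <= s -> s <= T -> source_map g' s x = g' s x].
Proof.
move=> sV' g'; have ag' : admissible g'.
  by apply: admissible_source (mild_C1inf sV') (mild_continuous sV').
have VE t : 0 <= t -> t <= T -> V' t = mild_map g' t.
  by move=> t0 tT; apply/funext => x; rewrite (mild_eq sV').
by split=> // s x s0 sT; rewrite /source_map -VE.
Qed.

(** Applying the contraction [n] times to the same pair divides the initial bound on the difference
    by [2^n], for every [n]. *)
Lemma source_map_fixpoint_unique g g' : admissible g -> admissible g' ->
  (forall s x, 0 <= s -> s <= T -> source_map g s x = g s x) ->
  (forall s x, 0 <= s -> s <= T -> source_map g' s x = g' s x) ->
  forall s x, 0 <= s -> s <= T -> g s x = g' s x.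
Proof.
move=> ag ag' fg fg' s x s0 sT.
have [l l0 lw] := contraction_rate.
have [_ _ [M gM]] := admissibleB ag ag'.
have M0 : 0 <= M by apply: le_trans (gM 0 0 _ (ltW T0)).
have dec n r y : 0 <= r -> r <= T ->
    `|g r y - g' r y| <= M / 2 ^+ n * expR (l * (T - r)).
  elim: n r y => [|n IH] r y r0 rT.
    rewrite expr0 divr1; apply: le_trans (gM r y r0 rT) _.
    by rewrite ler_peMr// -expR0 ler_expR mulr_ge0// subr_ge0.
  have := source_map_contraction ag ag' l0 lw IH y r0 rT.
  by rewrite fg// fg'// exprS invfM mulrA [M / 2 / _]mulrAC.
apply/eqP; rewrite -subr_eq0; apply/eqP.
apply: (@le_pow2_eq0 _ _ (M * expR (l * (T - s)))) => n.
by rewrite mulrAC; exact: dec.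
Qed.

Lemma mild_map_eq g g' t x : (forall s y, 0 <= s -> s <= T -> g s y = g' s y) ->
  0 <= t -> mild_map g t x = mild_map g' t x.
Proof.
move=> gg' t0; congr (_ + _); apply: eq_Rintegral => s.
rewrite inE /= in_itv /= => /andP[ts sT]; congr (U t s _ x).
by apply/funext => y; apply: gg' => //; exact: le_trans ts.
Qed.

End Duhamel.

(** Uniqueness is asserted on [[0, T]], the only times at which [mild_solution] constrains a
    curve. *)
Theorem theorem5p1 (R : realType) (d : nat) (T : R)
  (H : R -> 'rV[R]_d -> 'rV[R]_d -> R) (c1 h c2 : R)
  (D : completeNormedModType R) (j : D -> 'rV[R]_d -> R)
  (L : R -> D -> 'rV[R]_d -> R)
  (U : R -> R -> ('rV[R]_d -> R) -> ('rV[R]_d -> R)) (w : R -> R) :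
  0 < T ->
  (* (1) *)
  (forall x p, {within `[0, T], continuous (fun t => H t x p)}) ->
  0 < c1 ->
  (forall t x p p', 0 <= t -> t <= T ->
     `|H t x p - H t x p'| <= c1 * euclid (p - p')) ->
  0 < h ->
  (forall t x, 0 <= t -> t <= T -> `|H t x 0| <= h) ->
  (* implicit in the mild equation: U^{t,s} acts on H_s(., grad f) *)
  (forall t f, 0 <= t -> t <= T -> C1inf f ->
     Cinf (fun x => H t x (grad f x))) ->
  (* (2) *)
  backward_propagator T Cinf supnorm U ->
  strongly_continuous T Cinf supnorm U ->
  generates T j Cinf supnorm L U ->
  (forall u, C1inf (j u)) ->
  (forall t s f, 0 <= t -> t <= s -> s <= T -> C1inf f -> C1inf (U t s f)) ->
  strongly_continuous T C1inf C1norm U ->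
  0 < c2 ->
  (forall t s f, 0 <= t -> t <= s -> s <= T -> C1inf f ->
     C1norm (U t s f) <= c2 * C1norm f) ->
  (forall t s f, 0 <= t -> t <= s -> s <= T -> Cinf f ->
     supnorm (U t s f) <= c2 * supnorm f) ->
  (* (3) *)
  (forall t s f, 0 <= t -> t < s -> s <= T -> Cinf f -> C1inf (U t s f)) ->
  (forall u, 0 <= u -> u <= T -> 0 < w u) ->
  (@lebesgue_measure R).-integrable `[0, T] (fun u => (w u)%:E) ->
  (forall t s f, 0 <= t -> t < s -> s < T -> Cinf f ->
     C1norm (U t s f) <= w (s - t) * supnorm f) ->
  forall VT : 'rV[R]_d -> R, C1inf VT ->
  exists V : R -> 'rV[R]_d -> R,
    mild_solution T U H VT V /\
    (forall V', mild_solution T U H VT V' ->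
       forall t x, 0 <= t -> t <= T -> V' t x = V t x).
Proof.
move=> T0 contH c10 lipH _ boundH CinfH propU contU _ _ C1U contC1U c20 _ normU
  smoothU w0 iw normC1U VT C1VT.
have [g ag fg] := source_map_fixpoint T0 propU contU C1U contC1U c20 normU
  smoothU w0 iw normC1U C1VT contH c10 lipH boundH CinfH.
exists (mild_map T U VT g); split.
  exact: (mild_solution_exists T0 propU contU C1U contC1U c20 normU smoothU w0
    iw normC1U C1VT ag fg).
move=> V' sV' t x t0 tT.
(* The source of the second solution is an admissible fixed point, hence agrees with [g] on
   [[0, T]], and the source determines the solution there. *)
have [ag' VE fg'] := mild_solution_source contH c10 lipH boundH CinfH sV'.
rewrite VE//; apply: mild_map_eq => // s y s0 sT.
exact: (source_map_fixpoint_unique T0 propU contU C1U c20 normU smoothU w0 iw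
  normC1U C1VT c10 lipH ag' ag fg' fg y s0 sT).
Qed.
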